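(* Let $\mathcal{C}$ be a category equipped with an orthogonal factorisation system $(\mathcal{E},\mathcal{M})$ such that all $\mathcal{M}$-maps are monomorphisms, pullbacks of $\mathcal{M}$-maps along arbitrary morphisms exist, and each $A\in\mathcal{C}$ has only a finite set of $\mathcal{M}$-subobjects. Let $\mathcal{P}=\mathbf{Par}(\mathcal{C},\mathcal{M})$ and let $\mathcal{R}$ be the category of objects of $\mathcal{C}$ and $\mathcal{E}$-maps. For any (symmetric) $\mathbf{Ab}$-algebra $\mathcal{X}$ there is a (symmetric) $\mathbf{Ab}$-algebra structure $(\ast,J)$ on $[\mathcal{R},\mathcal{X}]$ whose unit $J$ and binary tensor $\ast$ are given (on objects $A$) by $$J(A)=\begin{cases}I&\text{if }|\mathrm{Sub}(A)|=1;\\0&\text{otherwise}\end{cases}\qquad\text{and}\qquad (F\ast G)(A)=\bigoplus_{\substack{B\leqslant_n A,\ B'\leqslant_{n'}A\\ n,n'\text{ are covering}}}FB\otimes GB'.$$ Moreover, the functor $\Gamma\colon[\mathcal{R},\mathcal{X}]\to[\mathcal{P},\mathcal{X}]$ is strong monoidal as a functor $([\mathcal{R},\mathcal{X}],\ast)\to([\mathcal{P},\mathcal{X}],\text{pointwise})$.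
   Context: An additive Karoubian category is an $\mathbf{Ab}$-enriched category with finite biproducts and splittings of idempotents. A (symmetric) $\mathbf{Ab}$-algebra is a (symmetric) monoidal additive Karoubian category (with tensor additive in each variable and unit $I$). $[\mathcal{P},\mathcal{X}]$ and $[\mathcal{R},\mathcal{X}]$ are ordinary functor categories; ''pointwise'' is the pointwise tensor product. $\mathbf{Par}(\mathcal{C},\mathcal{M})$ has the objects of $\mathcal{C}$; maps $A\to B$ are isomorphism classes of spans $(m,f)$, $A\xleftarrow{m}R\xrightarrow{f}B$ in $\mathcal{C}$, with $m\in\mathcal{M}$; composition is by pullback. For each $A\in\mathcal{C}$, $\mathrm{Sub}(A)$ is a chosen set of representatives of the $\mathcal{M}$-subobjects of $A$; $B\leqslant_n A$ means that $n\colon B\to A$ is in $\mathrm{Sub}(A)$. A pair $n,n'\in\mathrm{Sub}(A)$ is covering if any $\mathcal{M}$-map (with codomain $A$) through which both $n$ and $n'$ factor is invertible. The functor $\Gamma\colon[\mathcal{R},\mathcal{X}]\to[\mathcal{P},\mathcal{X}]$ (which is an equivalence, by work of Lack and Street) is defined for $F\in[\mathcal{R},\mathcal{X}]$ by $(\Gamma F)A=\bigoplus_{B\leqslant_n A}FB$ on objects. On a map $(m,f)\colon A\to A'$ of $\mathcal{P}$, with $m\colon R\to A$ and $f\colon R\to A'$, $(\Gamma F)(m,f)$ is the matrix with entries $\xi(m,f)_{nn'}\colon FB\to FB'$, for $B\leqslant_n A$ and $B'\leqslant_{n'}A'$, where $\xi(m,f)_{nn'}=Fe$ if there are (necessarily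 unique) $p\colon B\to R$ in $\mathcal{M}$ and $e\colon B\to B'$ in $\mathcal{E}$ with $mp=n$ and $fp=n'e$, and $\xi(m,f)_{nn'}=0$ otherwise. *)

(* Defs.v *)
From HB Require Import structures.
From mathcomp Require Import all_boot all_algebra boolp.
Set Implicit Arguments.
Unset Strict Implicit.
Unset Printing Implicit Defensive.
Import GRing.Theory.
Local Open Scope ring_scope.
Local Open Scope quotient_scope.

Declare Scope cat_scope.
Delimit Scope cat_scope with cat.
Local Open Scope cat_scope.

Record category := Category {
  obj :> Type;
  hom : obj -> obj -> Type;
  idm : forall a, hom a a;
  cmp : forall a b c, hom b c -> hom a b -> hom a c;
  cmpA : forall a b c d (h : hom c d) (g : hom b c) (f : hom a b),
    cmp h (cmp g f) = cmp (cmp h g) f;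
  cmp1m : forall a b (f : hom a b), cmp (idm b) f = f;
  cmpm1 : forall a b (f : hom a b), cmp f (idm a) = f }.

Arguments idm {C} a : rename.
Arguments cmp {C a b c} g f : rename.
Notation "a ~> b" := (hom a b) (at level 70, no associativity) : cat_scope.
Notation "g ∘ f" := (cmp g f) (at level 40, left associativity) : cat_scope.

Definition is_iso (C : category) (a b : C) (f : a ~> b) : Prop :=
  exists g : b ~> a, g ∘ f = idm a /\ f ∘ g = idm b.

Definition monic (C : category) (a b : C) (m : a ~> b) : Prop :=
  forall (x : C) (u v : x ~> a), m ∘ u = m ∘ v -> u = v.

(* The cone [b <-p- r -q-> c] is a pullback of [b -f-> a <-g- c]. *)
Definition is_pullback (C : category) (a b c r : C)
    (f : b ~> a) (g : c ~> a) (p : r ~> b) (q : r ~> c) : Prop :=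
  f ∘ p = g ∘ q /\
  forall (x : C) (u : x ~> b) (v : x ~> c), f ∘ u = g ∘ v ->
    exists! w : x ~> r, p ∘ w = u /\ q ∘ w = v.

Record functor (C D : category) := Functor {
  fobj :> C -> D;
  fmap : forall a b, (a ~> b) -> (fobj a ~> fobj b);
  fmap1 : forall a, fmap (idm a) = idm (fobj a);
  fmapM : forall a b c (g : b ~> c) (f : a ~> b),
    fmap (g ∘ f) = fmap g ∘ fmap f }.

Arguments fmap {C D} F {a b} f : rename.

Record nat_trans (C D : category) (F G : functor C D) := NatTrans {
  nt :> forall a : C, F a ~> G a;
  ntN : forall (a b : C) (f : a ~> b), nt b ∘ fmap F f = fmap G f ∘ nt a }.

Lemma nat_trans_eq (C D : category) (F G : functor C D)
  (s t : nat_trans F G) : (forall a, s a = t a) -> s = t.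
Proof.
case: s t => [s sN] [t tN] /= st.
have e : s = t by apply: functional_extensionality_dep.
by rewrite {}e in sN *; congr NatTrans; apply: Prop_irrelevance.
Qed.

Section FunctorCategory.
Variables C D : category.

Definition nt_id (F : functor C D) : nat_trans F F.
Proof.
by exists (fun a => idm (F a)) => a b f; rewrite cmp1m cmpm1.
Defined.

Definition nt_cmp (F G H : functor C D)
  (t : nat_trans G H) (s : nat_trans F G) : nat_trans F H.
Proof.
by exists (fun a => t a ∘ s a) => a b f; rewrite -cmpA ntN cmpA ntN cmpA.
Defined.

Definition functor_category : category.
Proof.
exists (functor C D) (@nat_trans C D) nt_id nt_cmp.
- by move=> F G H K u t s; apply: nat_trans_eq => a; apply: cmpA.
- by move=> F G s; apply: nat_trans_eq => a; apply: cmp1m.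
- by move=> F G s; apply: nat_trans_eq => a; apply: cmpm1.
Defined.

End FunctorCategory.

(* In the two distributivity fields, [Z x y] is the abelian group of maps from
   [x] to [y]. *)
Record ab_category := AbCategory {
  ab_cat :> category;
  ab_zmod : forall a b : ab_cat, GRing.Zmodule (a ~> b);
  ab_cmpDl : forall (a b c : ab_cat) (f : a ~> b),
    let Z (x y : ab_cat) : zmodType := HB.pack (x ~> y) (ab_zmod x y) in
    {morph (fun g : Z b c => g ∘ f : Z a c) : g h / g + h};
  ab_cmpDr : forall (a b c : ab_cat) (h : b ~> c),
    let Z (x y : ab_cat) : zmodType := HB.pack (x ~> y) (ab_zmod x y) in
    {morph (fun f : Z a b => h ∘ f : Z a c) : f g / f + g} }.

HB.instance Definition _ (X : ab_category) (a b : X) := ab_zmod a b.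

Section AbLemmas.
Variable X : ab_category.
Implicit Types a b c : X.

Lemma cmpDl a b c (g h : b ~> c) (f : a ~> b) :
  (g + h) ∘ f = g ∘ f + h ∘ f.
Proof. exact: ab_cmpDl. Qed.

Lemma cmpDr a b c (h : b ~> c) (f g : a ~> b) :
  h ∘ (f + g) = h ∘ f + h ∘ g.
Proof. exact: ab_cmpDr. Qed.

Lemma cmp0m a b c (f : a ~> b) : (0 : b ~> c) ∘ f = 0.
Proof. by apply: (addrI ((0 : b ~> c) ∘ f)); rewrite -cmpDl !addr0. Qed.

Lemma cmpm0 a b c (h : b ~> c) : h ∘ (0 : a ~> b) = 0.
Proof. by apply: (addrI (h ∘ (0 : a ~> b))); rewrite -cmpDr !addr0. Qed.

Lemma cmp_suml a b c (I : finType) (g : I -> (b ~> c)) (f : a ~> b) :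
  (\sum_i g i) ∘ f = \sum_i (g i ∘ f).
Proof.
by apply: (big_morph (fun g => g ∘ f)) => [u v|]; rewrite (cmpDl, cmp0m).
Qed.

Lemma cmp_sumr a b c (I : finType) (h : b ~> c) (f : I -> (a ~> b)) :
  h ∘ (\sum_i f i) = \sum_i (h ∘ f i).
Proof.
by apply: (big_morph (fun f => h ∘ f)) => [u v|]; rewrite (cmpDr, cmpm0).
Qed.

End AbLemmas.

Section FunctorAb.
Variables (D : category) (X : ab_category).

HB.instance Definition _ (F G : functor D X) := gen_eqMixin (nat_trans F G).
HB.instance Definition _ (F G : functor D X) :=
  gen_choiceMixin (nat_trans F G).

Section Zmod.
Variables F G : functor D X.
Implicit Types s t : nat_trans F G.

Definition nt_zero : nat_trans F G.
Proof. by exists (fun _ => 0) => a b f; rewrite cmp0m cmpm0. Defined.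

Definition nt_opp s : nat_trans F G.
Proof.
exists (fun a => - s a) => a b f.
apply: (addrI (s b ∘ fmap F f)).
by rewrite -cmpDl subrr cmp0m ntN -cmpDr subrr cmpm0.
Defined.

Definition nt_add s t : nat_trans F G.
Proof.
by exists (fun a => s a + t a) => a b f; rewrite cmpDl cmpDr !ntN.
Defined.

Lemma nt_addA : associative nt_add.
Proof. by move=> r s t; apply: nat_trans_eq => a; apply: addrA. Qed.

Lemma nt_addC : commutative nt_add.
Proof. by move=> s t; apply: nat_trans_eq => a; apply: addrC. Qed.

Lemma nt_add0 : left_id nt_zero nt_add.
Proof. by move=> s; apply: nat_trans_eq => a; apply: add0r. Qed.

Lemma nt_addN : left_inverse nt_zero nt_opp nt_add.
Proof. by move=> s; apply: nat_trans_eq => a; apply: addNr. Qed.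

HB.instance Definition _ :=
  GRing.isZmodule.Build (nat_trans F G) nt_addA nt_addC nt_add0 nt_addN.

End Zmod.

Definition functor_ab_category : ab_category.
Proof.
exists (functor_category D X) (fun F G => GRing.Zmodule.on (nat_trans F G)).
- move=> F G H s Z t u /=.
  by apply: (@nat_trans_eq D X F H) => a; apply: cmpDl.
- move=> F G H s Z t u /=.
  by apply: (@nat_trans_eq D X F H) => a; apply: cmpDr.
Defined.

End FunctorAb.

(* Finite biproducts are given as chosen biproducts of families indexed by a
   finite type; the empty family provides the zero object. *)
Record additive_karoubian (X : ab_category) := AdditiveKaroubian {
  dsum : forall I : finType, (I -> X) -> X;
  inj : forall (I : finType) (D : I -> X) (i : I), D i ~> dsum D;
  proj : forall (I : finType) (D : I -> X) (i : I), dsum D ~> D i;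
  proj_injE : forall (I : finType) (D : I -> X) i, proj D i ∘ inj D i = idm (D i);
  proj_inj0 : forall (I : finType) (D : I -> X) i j,
    i <> j -> proj D j ∘ inj D i = 0;
  inj_proj : forall (I : finType) (D : I -> X),
    \sum_i (inj D i ∘ proj D i) = idm (dsum D);
  idempotents_split : forall (a : X) (e : a ~> a), e ∘ e = e ->
    exists (b : X) (r : a ~> b) (s : b ~> a), r ∘ s = idm b /\ s ∘ r = e }.

Arguments dsum {X} K {I} D : rename.
Arguments inj {X} K {I} D i : rename.
Arguments proj {X} K {I} D i : rename.

Section Matrices.
Variables (X : ab_category) (K : additive_karoubian X).

Definition zero_obj : X := dsum K (fun i : void => match i with end).

(* [u i j] is the component from the [i]-th summand to the [j]-th one. *)
Definition mx_hom (I J : finType) (D : I -> X) (D' : J -> X)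
    (u : forall i j, D i ~> D' j) : dsum K D ~> dsum K D' :=
  \sum_i \sum_j (inj K D' j ∘ u i j ∘ proj K D i).

Lemma mx_hom_ext (I J : finType) (D : I -> X) (D' : J -> X)
    (u v : forall i j, D i ~> D' j) :
  (forall i j, u i j = v i j) -> mx_hom u = mx_hom v.
Proof. by move=> e; apply: eq_bigr => i _; apply: eq_bigr => j _; rewrite e. Qed.

Lemma proj_mx_hom (I J : finType) (D : I -> X) (D' : J -> X)
    (u : forall i j, D i ~> D' j) j :
  proj K D' j ∘ mx_hom u = \sum_i (u i j ∘ proj K D i).
Proof.
rewrite /mx_hom cmp_sumr; apply: eq_bigr => i _.
rewrite cmp_sumr (bigD1 j) //= big1 ?addr0 => [|k /eqP kj].
  by rewrite !cmpA proj_injE cmp1m.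
by rewrite !cmpA proj_inj0 // !cmp0m.
Qed.

Lemma mx_hom_comp (I J L : finType) (D : I -> X) (D' : J -> X) (D'' : L -> X)
    (u : forall i j, D i ~> D' j) (v : forall j l, D' j ~> D'' l) :
  mx_hom v ∘ mx_hom u = mx_hom (fun i l => \sum_j (v j l ∘ u i j)).
Proof.
rewrite {1}/mx_hom cmp_suml.
under eq_bigr => j _.
  rewrite cmp_suml; under eq_bigr => l _ do rewrite -cmpA proj_mx_hom cmp_sumr.
  rewrite exchange_big; over.
rewrite exchange_big /=; apply: eq_bigr => i _.
rewrite exchange_big /=; apply: eq_bigr => l _.
rewrite cmp_sumr cmp_suml; apply: eq_bigr => j _.
by rewrite !cmpA.
Qed.

Lemma mx_hom1 (I : finType) (D : I -> X) (u : forall i j, D i ~> D j) :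
  (forall i, u i i = idm (D i)) -> (forall i j, i <> j -> u i j = 0) ->
  mx_hom u = idm (dsum K D).
Proof.
move=> u1 u0; rewrite -inj_proj; apply: eq_bigr => i _.
rewrite (bigD1 i) //= big1 ?addr0 => [|j /eqP ij]; first by rewrite u1 cmpm1.
by rewrite u0 ?cmpm0 ?cmp0m // => ji; apply: ij.
Qed.

Definition diag_hom (I : finType) (D D' : I -> X)
    (u : forall i, D i ~> D' i) : dsum K D ~> dsum K D' :=
  \sum_i (inj K D' i ∘ u i ∘ proj K D i).

Lemma diag_mx_hom (I J : finType) (D : I -> X) (D' D'' : J -> X)
    (u : forall i j, D i ~> D' j) (v : forall j, D' j ~> D'' j) :
  diag_hom v ∘ mx_hom u = mx_hom (fun i j => v j ∘ u i j).
Proof.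
rewrite {1}/diag_hom cmp_suml.
under eq_bigr => j _ do rewrite -cmpA proj_mx_hom cmp_sumr.
rewrite exchange_big /=; apply: eq_bigr => i _; apply: eq_bigr => j _.
by rewrite !cmpA.
Qed.

Lemma mx_diag_hom (I J : finType) (D D' : I -> X) (D'' : J -> X)
    (u : forall i, D i ~> D' i) (v : forall i j, D' i ~> D'' j) :
  mx_hom v ∘ diag_hom u = mx_hom (fun i j => v i j ∘ u i).
Proof.
rewrite {1}/mx_hom cmp_suml; apply: eq_bigr => i _.
rewrite cmp_suml; apply: eq_bigr => j _.
rewrite /diag_hom cmp_sumr (bigD1 i) //= big1 ?addr0 => [|k /eqP ki].
  by rewrite !cmpA -(cmpA _ (proj K D' i)) proj_injE cmpm1.
by rewrite !cmpA -(cmpA _ (proj K D' i)) proj_inj0 // cmpm0 !cmp0m.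
Qed.

Lemma diag_hom1 (I : finType) (D : I -> X) :
  diag_hom (fun i => idm (D i)) = idm (dsum K D).
Proof. by rewrite -inj_proj; apply: eq_bigr => i _; rewrite cmpm1. Qed.

Lemma diag_hom_comp (I : finType) (D D' D'' : I -> X)
    (u : forall i, D i ~> D' i) (v : forall i, D' i ~> D'' i) :
  diag_hom v ∘ diag_hom u = diag_hom (fun i => v i ∘ u i).
Proof.
rewrite {1}/diag_hom cmp_suml; apply: eq_bigr => i _.
rewrite /diag_hom cmp_sumr (bigD1 i) //= big1 ?addr0 => [|k /eqP ki].
  by rewrite !cmpA -(cmpA _ (proj K D' i)) proj_injE cmpm1.
by rewrite !cmpA -(cmpA _ (proj K D' i)) proj_inj0 // cmpm0 !cmp0m.
Qed.

End Matrices.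

Record monoidal (C : category) := Monoidal {
  tens : C -> C -> C;
  tensh : forall a b a' b' : C,
    (a ~> a') -> (b ~> b') -> (tens a b ~> tens a' b');
  tens1 : forall a b, tensh (idm a) (idm b) = idm (tens a b);
  tensM : forall (a b a' b' a'' b'' : C) (f' : a' ~> a'') (g' : b' ~> b'')
    (f : a ~> a') (g : b ~> b'),
    tensh (f' ∘ f) (g' ∘ g) = tensh f' g' ∘ tensh f g;
  tunit : C;
  assoc : forall a b c : C, tens (tens a b) c ~> tens a (tens b c);
  lunit : forall a : C, tens tunit a ~> a;
  runit : forall a : C, tens a tunit ~> a;
  assoc_iso : forall a b c, is_iso (assoc a b c);
  lunit_iso : forall a, is_iso (lunit a);
  runit_iso : forall a, is_iso (runit a);
  assocN : forall (a b c a' b' c' : C)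
    (f : a ~> a') (g : b ~> b') (h : c ~> c'),
    assoc a' b' c' ∘ tensh (tensh f g) h =
    tensh f (tensh g h) ∘ assoc a b c;
  lunitN : forall (a b : C) (f : a ~> b),
    lunit b ∘ tensh (idm tunit) f = f ∘ lunit a;
  runitN : forall (a b : C) (f : a ~> b),
    runit b ∘ tensh f (idm tunit) = f ∘ runit a;
  pentagon : forall a b c d : C,
    assoc a b (tens c d) ∘ assoc (tens a b) c d =
    tensh (idm a) (assoc b c d) ∘ assoc a (tens b c) d ∘
      tensh (assoc a b c) (idm d);
  triangle : forall a b : C,
    tensh (idm a) (lunit b) ∘ assoc a tunit b = tensh (runit a) (idm b) }.

Arguments tens {C} T a b : rename.
Arguments tensh {C} T {a b a' b'} f g : rename.
Arguments tunit {C} T : rename.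
Arguments assoc {C} T a b c : rename.
Arguments lunit {C} T a : rename.
Arguments runit {C} T a : rename.

Record symmetry (C : category) (T : monoidal C) := Symmetry {
  braid : forall a b : C, tens T a b ~> tens T b a;
  braidN : forall (a b a' b' : C) (f : a ~> a') (g : b ~> b'),
    braid a' b' ∘ tensh T f g = tensh T g f ∘ braid a b;
  braidK : forall a b : C, braid b a ∘ braid a b = idm (tens T a b);
  hexagon : forall a b c : C,
    assoc T b c a ∘ braid a (tens T b c) ∘ assoc T a b c =
    tensh T (idm b) (braid a c) ∘ assoc T b a c ∘
      tensh T (braid a b) (idm c) }.

Record strong_monoidal (C D : category) (S : monoidal C) (T : monoidal D)
    (F : functor C D) := StrongMonoidal {
  smu : forall a b : C, tens T (F a) (F b) ~> F (tens S a b);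
  seta : tunit T ~> F (tunit S);
  smu_iso : forall a b, is_iso (smu a b);
  seta_iso : is_iso seta;
  smuN : forall (a b a' b' : C) (f : a ~> a') (g : b ~> b'),
    smu a' b' ∘ tensh T (fmap F f) (fmap F g) =
    fmap F (tensh S f g) ∘ smu a b;
  smu_assoc : forall a b c : C,
    fmap F (assoc S a b c) ∘ smu (tens S a b) c ∘
      tensh T (smu a b) (idm (F c)) =
    smu a (tens S b c) ∘ tensh T (idm (F a)) (smu b c) ∘
      assoc T (F a) (F b) (F c);
  smu_lunit : forall a : C,
    fmap F (lunit S a) ∘ smu (tunit S) a ∘ tensh T seta (idm (F a)) =
    lunit T (F a);
  smu_runit : forall a : C,
    fmap F (runit S a) ∘ smu a (tunit S) ∘ tensh T (idm (F a)) seta =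
    runit T (F a) }.

Record ab_algebra (X : ab_category) := AbAlgebra {
  ab_add : additive_karoubian X;
  ab_mon : monoidal X;
  tensDl : forall (a b a' b' : X) (f f' : a ~> a') (g : b ~> b'),
    tensh ab_mon (f + f') g = tensh ab_mon f g + tensh ab_mon f' g;
  tensDr : forall (a b a' b' : X) (f : a ~> a') (g g' : b ~> b'),
    tensh ab_mon f (g + g') = tensh ab_mon f g + tensh ab_mon f g' }.

Coercion ab_add : ab_algebra >-> additive_karoubian.
Coercion ab_mon : ab_algebra >-> monoidal.

Section Pointwise.
Variables (D C : category) (T : monoidal C).

Definition pt_tens (F G : functor D C) : functor D C.
Proof.
exists (fun a => tens T (F a) (G a))
  (fun a b f => tensh T (fmap F f) (fmap G f)).
- by move=> a; rewrite !fmap1 tens1.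
- by move=> a b c g f; rewrite !fmapM tensM.
Defined.

Definition pt_tensh (F G F' G' : functor D C)
  (s : nat_trans F F') (t : nat_trans G G') :
  nat_trans (pt_tens F G) (pt_tens F' G').
Proof.
exists (fun a => tensh T (s a) (t a)) => a b f /=.
by rewrite -!tensM !ntN.
Defined.

Definition pt_unit : functor D C.
Proof.
by exists (fun _ => tunit T) (fun _ _ _ => idm (tunit T)) => *; rewrite ?cmp1m.
Defined.

Definition pt_assoc (F G H : functor D C) :
  nat_trans (pt_tens (pt_tens F G) H) (pt_tens F (pt_tens G H)).
Proof.
by exists (fun a => assoc T (F a) (G a) (H a)) => a b f; apply: assocN.
Defined.

Definition pt_lunit (F : functor D C) : nat_trans (pt_tens pt_unit F) F.
Proof. by exists (fun a => lunit T (F a)) => a b f; apply: lunitN. Defined.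

Definition pt_runit (F : functor D C) : nat_trans (pt_tens F pt_unit) F.
Proof. by exists (fun a => runit T (F a)) => a b f; apply: runitN. Defined.

Lemma pt_iso (F G : functor D C) (s : nat_trans F G) :
  (forall a, is_iso (s a)) -> @is_iso (functor_category D C) F G s.
Proof.
move=> siso; pose g a := projT1 (cid (siso a)).
have gs a : g a ∘ s a = idm (F a) by rewrite /g; case: cid => ? [].
have sg a : s a ∘ g a = idm (G a) by rewrite /g; case: cid => ? [].
have gN a b (f : a ~> b) : g b ∘ fmap G f = fmap F f ∘ g a.
  by rewrite -[LHS]cmpm1 -(sg a) cmpA -(cmpA (g b)) -ntN cmpA gs cmp1m.
by exists (NatTrans gN); split; apply: nat_trans_eq => a /=.
Qed.

Definition pointwise : monoidal (functor_category D C).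
Proof.
unshelve econstructor.
- exact: pt_tens.
- exact: pt_tensh.
- exact: pt_unit.
- exact: pt_assoc.
- exact: pt_lunit.
- exact: pt_runit.
- by move=> F G; apply: nat_trans_eq => a; apply: tens1.
- by move=> *; apply: nat_trans_eq => a; apply: tensM.
- by move=> *; apply: pt_iso => a; apply: assoc_iso.
- by move=> *; apply: pt_iso => a; apply: lunit_iso.
- by move=> *; apply: pt_iso => a; apply: runit_iso.
- by move=> *; apply: nat_trans_eq => a; apply: assocN.
- by move=> *; apply: nat_trans_eq => a; apply: lunitN.
- by move=> *; apply: nat_trans_eq => a; apply: runitN.
- by move=> *; apply: nat_trans_eq => a; apply: pentagon.
- by move=> *; apply: nat_trans_eq => a; apply: triangle.
Defined.

End Pointwise.

Record factorisation_system (C : category) := FactorisationSystem {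
  Ecl : forall a b : C, (a ~> b) -> Prop;
  Mcl : forall a b : C, (a ~> b) -> Prop;
  E_iso : forall (a b : C) (f : a ~> b), is_iso f -> Ecl f;
  M_iso : forall (a b : C) (f : a ~> b), is_iso f -> Mcl f;
  E_cmp : forall (a b c : C) (g : b ~> c) (f : a ~> b),
    Ecl g -> Ecl f -> Ecl (g ∘ f);
  M_cmp : forall (a b c : C) (g : b ~> c) (f : a ~> b),
    Mcl g -> Mcl f -> Mcl (g ∘ f);
  EM_factor : forall (a b : C) (f : a ~> b),
    exists (c : C) (e : a ~> c) (m : c ~> b), Ecl e /\ Mcl m /\ m ∘ e = f;
  EM_orthogonal : forall (a b c d : C)
    (e : a ~> b) (m : c ~> d) (u : a ~> c) (v : b ~> d),
    Ecl e -> Mcl m -> m ∘ u = v ∘ e ->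
    exists! w : b ~> c, w ∘ e = u /\ m ∘ w = v }.

Arguments Ecl {C} W {a b} f : rename.
Arguments Mcl {C} W {a b} f : rename.

Definition M_monic (C : category) (W : factorisation_system C) : Prop :=
  forall (a b : C) (m : a ~> b), Mcl W m -> monic m.

Definition M_pullbacks (C : category) (W : factorisation_system C) : Prop :=
  forall (a b c : C) (m : b ~> a) (f : c ~> a), Mcl W m ->
    exists (r : C) (p : r ~> b) (q : r ~> c), is_pullback m f p q.

Section FactorisationLemmas.
Variables (C : category) (W : factorisation_system C).

Lemma iso_idm (a : C) : is_iso (idm a).
Proof. by exists (idm a); rewrite !cmp1m. Qed.

Lemma EM_unique (a b c d : C) (e : a ~> b) (m : b ~> d)
    (e' : a ~> c) (m' : c ~> d) :
  Ecl W e -> Mcl W m -> Ecl W e' -> Mcl W m' -> m ∘ e = m' ∘ e' ->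
  exists i : b ~> c, is_iso i /\ i ∘ e = e' /\ m' ∘ i = m.
Proof.
move=> Ee Mm Ee' Mm' eq.
have [i [[ie mi] _]] := EM_orthogonal Ee Mm' (esym eq).
have [j [[je mj] _]] := EM_orthogonal Ee' Mm eq.
exists i; do 2?split=> //; exists j; split.
- have [w [_ w_uniq]] := EM_orthogonal Ee Mm (erefl (m ∘ e)).
  rewrite -(w_uniq (j ∘ i)) ?(w_uniq (idm b)) //; first by rewrite cmp1m cmpm1.
  by rewrite -cmpA ie je cmpA mj mi.
- have [w [_ w_uniq]] := EM_orthogonal Ee' Mm' (erefl (m' ∘ e')).
  rewrite -(w_uniq (i ∘ j)) ?(w_uniq (idm c)) //; first by rewrite cmp1m cmpm1.
  by rewrite -cmpA je ie cmpA mi mj.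
Qed.

Lemma M_cancel (a b c : C) (m : b ~> c) (p : a ~> b) :
  Mcl W m -> Mcl W (m ∘ p) -> Mcl W p.
Proof.
move=> Mm Mmp; have [d [e [s [Ee [Ms se]]]]] := EM_factor W p.
have E1 : Ecl W (idm a) by apply/E_iso/iso_idm.
have eq : (m ∘ s) ∘ e = (m ∘ p) ∘ idm a by rewrite cmpm1 -cmpA se.
have [i [[j [ji ij]] [ie _]]] := EM_unique Ee (M_cmp Mm Ms) E1 Mmp eq.
rewrite -se; apply/M_cmp => //; apply: M_iso; exists i; split=> //.
by rewrite -[e]cmp1m -ji -(cmpA _ i) ie cmpm1.
Qed.

Lemma M_pullback (a b c r : C) (m : b ~> a) (f : c ~> a)
    (p : r ~> b) (q : r ~> c) :
  Mcl W m -> is_pullback m f p q -> Mcl W q.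
Proof.
move=> Mm [sq univ]; have [d [e [s [Ee [Ms se]]]]] := EM_factor W q.
have eq : m ∘ p = (f ∘ s) ∘ e by rewrite sq -se cmpA.
have [w [[we mw] _]] := EM_orthogonal Ee Mm eq.
have [u [[pu qu] _]] := univ _ _ _ mw.
have ue : u ∘ e = idm r.
  have [v [_ v_uniq]] := univ _ _ _ sq.
  rewrite -(v_uniq (u ∘ e)) ?(v_uniq (idm r)) //; first by rewrite !cmpm1.
  by rewrite !cmpA pu qu we se.
have eu : e ∘ u = idm d.
  have [v [_ v_uniq]] := EM_orthogonal Ee Ms (erefl (s ∘ e)).
  rewrite -(v_uniq (e ∘ u)) ?(v_uniq (idm d)) //; first by rewrite cmp1m cmpm1.
  by rewrite -cmpA ue cmpm1 cmpA se qu.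
by rewrite -se; apply/M_cmp => //; apply: M_iso; exists u.
Qed.

End FactorisationLemmas.

Section Ecategory.
Variables (C : category) (W : factorisation_system C).

Definition E_hom (a b : C) := {f : a ~> b | Ecl W f}.

Lemma E_hom_eq (a b : C) (f g : E_hom a b) : sval f = sval g -> f = g.
Proof. exact: eq_sig_hprop (fun _ => @Prop_irrelevance _) _ _. Qed.

Definition E_idm (a : C) : E_hom a a := exist _ _ (E_iso W (iso_idm a)).

Definition E_comp (a b c : C) (g : E_hom b c) (f : E_hom a b) : E_hom a c :=
  exist _ _ (E_cmp (svalP g) (svalP f)).

Definition E_category : category.
Proof.
exists C E_hom E_idm E_comp.
- by move=> a b c d h g f; apply: E_hom_eq; apply: cmpA.
- by move=> a b f; apply: E_hom_eq; apply: cmp1m.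
- by move=> a b f; apply: E_hom_eq; apply: cmpm1.
Defined.

End Ecategory.

Section Par.
Variables (C : category) (W : factorisation_system C).

Record span (a b : C) := Span {
  sp_obj : C;
  sp_m : sp_obj ~> a;
  sp_f : sp_obj ~> b;
  sp_M : Mcl W sp_m }.

HB.instance Definition _ (a b : C) := gen_eqMixin (span a b).
HB.instance Definition _ (a b : C) := gen_choiceMixin (span a b).

Definition span_iso (a b : C) (s t : span a b) : Prop :=
  exists i : sp_obj s ~> sp_obj t,
    is_iso i /\ sp_m t ∘ i = sp_m s /\ sp_f t ∘ i = sp_f s.

Lemma span_iso_refl (a b : C) (s : span a b) : span_iso s s.
Proof. by exists (idm _); rewrite !cmpm1; split=> //; apply: iso_idm. Qed.

Lemma span_iso_sym (a b : C) (s t : span a b) : span_iso s t -> span_iso t s.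
Proof.
move=> [i [[j [ji ij]] [mi fi]]]; exists j; split; first by exists i.
by rewrite -mi -fi -!cmpA ij !cmpm1.
Qed.

Lemma span_iso_trans (a b : C) (s t u : span a b) :
  span_iso s t -> span_iso t u -> span_iso s u.
Proof.
move=> [i [[i' [i'i ii']] [mi fi]]] [j [[j' [j'j jj']] [mj fj]]].
exists (j ∘ i); split; last by rewrite !cmpA mj fj mi fi.
exists (i' ∘ j'); split.
- by rewrite -cmpA (cmpA j') j'j cmp1m.
- by rewrite -cmpA (cmpA i) ii' cmp1m.
Qed.

Definition span_rel (a b : C) : rel (span a b) :=
  fun s t => `[< span_iso s t >].

Lemma span_rel_refl (a b : C) : reflexive (@span_rel a b).
Proof. by move=> s; apply/asboolP/span_iso_refl. Qed.

Lemma span_rel_sym (a b : C) : ssrbool.symmetric (@span_rel a b).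
Proof. by move=> s t; apply/asboolP/asboolP; apply: span_iso_sym. Qed.

Lemma span_rel_trans (a b : C) : transitive (@span_rel a b).
Proof.
by move=> t s u /asboolP st /asboolP tu; apply/asboolP/(span_iso_trans st tu).
Qed.

Canonical span_equiv (a b : C) : equiv_rel (span a b) :=
  EquivRel (@span_rel a b) (@span_rel_refl a b) (@span_rel_sym a b)
    (@span_rel_trans a b).

Definition par_hom (a b : C) := {eq_quot span_equiv a b}.

Definition span_class (a b : C) (s : span a b) : par_hom a b :=
  \pi_({eq_quot span_equiv a b}) s.

Definition par_repr (a b : C) (h : par_hom a b) : span a b := repr h.

Lemma span_classP (a b : C) (s t : span a b) :
  span_class s = span_class t <-> span_iso s t.
Proof.
split=> [/eqmodP/asboolP|st] //; by apply/eqmodP/asboolP.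
Qed.

Lemma par_reprK (a b : C) (h : par_hom a b) : span_class (par_repr h) = h.
Proof. exact: reprK. Qed.

Lemma par_repr_iso (a b : C) (s : span a b) :
  span_iso (par_repr (span_class s)) s.
Proof. by apply/span_classP/par_reprK. Qed.

Lemma par_homP (a b : C) (P : par_hom a b -> Prop) :
  (forall s, P (span_class s)) -> forall h, P h.
Proof. by move=> Ps h; rewrite -(par_reprK h). Qed.

Definition id_span (a : C) : span a a :=
  @Span a a a (idm a) (idm a) (M_iso W (iso_idm a)).

Hypotheses (Wmono : M_monic W) (Wpb : M_pullbacks W).

Section Composite.
Variables (a b c : C) (t : span b c) (s : span a b).

Definition pb_obj : C := projT1 (cid (Wpb (sp_f s) (sp_M t))).
Definition pb_fst : pb_obj ~> sp_obj t :=
  projT1 (cid (projT2 (cid (Wpb (sp_f s) (sp_M t))))).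
Definition pb_snd : pb_obj ~> sp_obj s :=
  projT1 (cid (projT2 (cid (projT2 (cid (Wpb (sp_f s) (sp_M t))))))).

Lemma pbP : is_pullback (sp_m t) (sp_f s) pb_fst pb_snd.
Proof.
exact: projT2 (cid (projT2 (cid (projT2 (cid (Wpb (sp_f s) (sp_M t))))))).
Qed.

Definition span_comp : span a c :=
  @Span a c pb_obj (sp_m s ∘ pb_snd) (sp_f t ∘ pb_fst)
    (M_cmp (sp_M s) (M_pullback (sp_M t) pbP)).

Lemma span_comp_lift (x : C) (u : x ~> sp_obj s) (v : x ~> sp_obj t) :
  sp_f s ∘ u = sp_m t ∘ v ->
  exists w : x ~> sp_obj span_comp,
    sp_m span_comp ∘ w = sp_m s ∘ u /\ sp_f span_comp ∘ w = sp_f t ∘ v.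
Proof.
move=> eq; have [_ univ] := pbP.
have [w [[<- <-] _]] := univ _ _ _ (esym eq).
by exists w; rewrite /= !cmpA.
Qed.

Lemma span_comp_elim (x : C) (w : x ~> sp_obj span_comp) :
  exists (u : x ~> sp_obj s) (v : x ~> sp_obj t),
  [/\ sp_f s ∘ u = sp_m t ∘ v, sp_m s ∘ u = sp_m span_comp ∘ w
    & sp_f t ∘ v = sp_f span_comp ∘ w].
Proof.
have [sq _] := pbP; exists (pb_snd ∘ w), (pb_fst ∘ w).
by rewrite !cmpA sq.
Qed.

End Composite.

Lemma span_iso_of_lifts (a b : C) (s t : span a b) :
  (exists i, sp_m t ∘ i = sp_m s /\ sp_f t ∘ i = sp_f s) ->
  (exists j, sp_m s ∘ j = sp_m t) -> span_iso s t.
Proof.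
move=> [i [mi fi]] [j mj]; exists i; split=> //; exists j; split.
- by apply: (Wmono (sp_M s)); rewrite cmpA mj mi cmpm1.
- by apply: (Wmono (sp_M t)); rewrite cmpA mi mj cmpm1.
Qed.

Lemma span_comp_iso (a b c : C) (t t' : span b c) (s s' : span a b) :
  span_iso t t' -> span_iso s s' -> span_iso (span_comp t s) (span_comp t' s').
Proof.
have half (u u' : span b c) (v v' : span a b) :
    span_iso u u' -> span_iso v v' -> exists i,
    sp_m (span_comp u' v') ∘ i = sp_m (span_comp u v) /\
    sp_f (span_comp u' v') ∘ i = sp_f (span_comp u v).
  move=> [i [_ [mi fi]]] [j [_ [mj fj]]].
  have [x [y [xy mx fy]]] := span_comp_elim (idm (sp_obj (span_comp u v))).
  have eq : sp_f v' ∘ (j ∘ x) = sp_m u' ∘ (i ∘ y) by rewrite !cmpA fj mi.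
  have [w [mw fw]] := span_comp_lift eq; exists w.
  by rewrite mw fw !cmpA mj fi mx fy !cmpm1.
move=> tt' ss'; apply: span_iso_of_lifts; first exact: half.
have [j [mj _]] := half _ _ _ _ (span_iso_sym tt') (span_iso_sym ss').
by exists j.
Qed.

Lemma span_compA (a b c d : C) (u : span c d) (t : span b c) (s : span a b) :
  span_iso (span_comp u (span_comp t s)) (span_comp (span_comp u t) s).
Proof.
apply: span_iso_of_lifts.
- set r := span_comp u _.
  have [x [y [xy mx fy]]] := span_comp_elim (idm (sp_obj r)).
  have [x' [y' [xy' mx' fy']]] := span_comp_elim x.
  have eq1 : sp_f t ∘ y' = sp_m u ∘ y by rewrite fy'.
  have [w [mw fw]] := span_comp_lift eq1.
  have eq2 : sp_f s ∘ x' = sp_m (span_comp u t) ∘ w by rewrite xy' mw.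
  have [z [mz fz]] := span_comp_lift eq2; exists z.
  by rewrite mz fz mx' mx fw fy !cmpm1.
- set r := span_comp _ s.
  have [x [y [xy mx fy]]] := span_comp_elim (idm (sp_obj r)).
  have [x' [y' [xy' mx' fy']]] := span_comp_elim y.
  have eq1 : sp_f s ∘ x = sp_m t ∘ x' by rewrite mx'.
  have [w [mw fw]] := span_comp_lift eq1.
  have eq2 : sp_f (span_comp t s) ∘ w = sp_m u ∘ y' by rewrite fw.
  have [z [mz fz]] := span_comp_lift eq2; exists z.
  by rewrite mz mw mx cmpm1.
Qed.

Lemma span_comp1s (a b : C) (s : span a b) :
  span_iso (span_comp (id_span b) s) s.
Proof.
apply: span_iso_of_lifts.
- set r := span_comp _ s.
  have [x [y [xy mx fy]]] := span_comp_elim (idm (sp_obj r)).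
  by exists x; rewrite mx xy /= fy !cmpm1.
- have eq : sp_f s ∘ idm _ = sp_m (id_span b) ∘ sp_f s by rewrite cmp1m cmpm1.
  have [w [mw _]] := span_comp_lift eq.
  by exists w; rewrite mw cmpm1.
Qed.

Lemma span_comps1 (a b : C) (s : span a b) :
  span_iso (span_comp s (id_span a)) s.
Proof.
apply: span_iso_of_lifts.
- set r := span_comp s _.
  have [x [y [xy mx fy]]] := span_comp_elim (idm (sp_obj r)).
  by exists y; rewrite -xy fy mx !cmpm1.
- have eq : sp_f (id_span a) ∘ sp_m s = sp_m s ∘ idm _ by rewrite cmp1m cmpm1.
  have [w [mw _]] := span_comp_lift eq.
  by exists w; rewrite mw cmp1m.
Qed.

Definition par_comp (a b c : C) (k : par_hom b c) (h : par_hom a b) :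
  par_hom a c := span_class (span_comp (par_repr k) (par_repr h)).

Lemma par_compE (a b c : C) (t : span b c) (s : span a b) :
  par_comp (span_class t) (span_class s) = span_class (span_comp t s).
Proof. by apply/span_classP/span_comp_iso; apply: par_repr_iso. Qed.

Definition Par : category.
Proof.
exists C par_hom (fun a => span_class (id_span a)) par_comp.
- move=> a b c d; elim/par_homP => u; elim/par_homP => t; elim/par_homP => s.
  by rewrite !par_compE; apply/span_classP/span_compA.
- move=> a b; elim/par_homP => s.
  by rewrite par_compE; apply/span_classP/span_comp1s.
- move=> a b; elim/par_homP => s.
  by rewrite par_compE; apply/span_classP/span_comps1.
Defined.

End Par.

(* A finite set [Sub a] of maps in [M] with codomain [a], containing exactly one
   representative of each [M]-subobject of [a]. *)
Record subobjects (C : category) (W : factorisation_system C) := Subobjects {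
  Sub : C -> finType;
  sub_obj : forall a : C, Sub a -> C;
  sub_map : forall (a : C) (n : Sub a), sub_obj n ~> a;
  sub_M : forall (a : C) (n : Sub a), Mcl W (sub_map n);
  sub_rep : forall (a b : C) (m : b ~> a), Mcl W m ->
    exists! n : Sub a, exists i : b ~> sub_obj n, is_iso i /\ sub_map n ∘ i = m }.

Arguments Sub {C W} S a : rename.
Arguments sub_obj {C W} S {a} n : rename.
Arguments sub_map {C W} S {a} n : rename.
Arguments sub_M {C W S a} n : rename.
Arguments sub_rep {C W} S {a b m} Mm : rename.

Definition factors (C : category) (a b c : C) (n : b ~> a) (m : c ~> a) : Prop :=
  exists u : b ~> c, m ∘ u = n.

Section Gamma.
Variables (C : category) (W : factorisation_system C).
Variables (Wmono : M_monic W) (Wpb : M_pullbacks W) (S : subobjects W).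

Definition covering (a : C) (n n' : Sub S a) : Prop :=
  forall (b : C) (m : b ~> a), Mcl W m ->
    factors (sub_map S n) m -> factors (sub_map S n') m -> is_iso m.

Definition xi_rel (a a' : C) (s : span W a a') (n : Sub S a) (n' : Sub S a')
    (e : E_hom W (sub_obj S n) (sub_obj S n')) : Prop :=
  exists p : sub_obj S n ~> sp_obj s,
  [/\ Mcl W p, sp_m s ∘ p = sub_map S n
    & sp_f s ∘ p = sub_map S n' ∘ sval e].

Lemma xi_rel_uniq (a a' : C) (s : span W a a') (n : Sub S a) (n' : Sub S a')
    (e e' : E_hom W (sub_obj S n) (sub_obj S n')) :
  xi_rel s e -> xi_rel s e' -> e = e'.
Proof.
move=> [p [_ mp fp]] [q [_ mq fq]]; apply: E_hom_eq.
apply: (Wmono (sub_M n')); rewrite -fp -fq; congr (_ ∘ _).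
by apply: (Wmono (sp_M s)); rewrite mp mq.
Qed.

Lemma sub_eq (a b : C) (n n' : Sub S a) (e : b ~> sub_obj S n)
    (e' : b ~> sub_obj S n') :
  Ecl W e -> Ecl W e' -> sub_map S n ∘ e = sub_map S n' ∘ e' -> n = n'.
Proof.
move=> Ee Ee' eq.
have [i [iso_i [_ mi]]] := EM_unique Ee (sub_M n) Ee' (sub_M n') eq.
have [n0 [_ n0_uniq]] := sub_rep S (sub_M n).
rewrite -(n0_uniq n); last first.
  by exists (idm _); rewrite cmpm1; split=> //; apply: iso_idm.
by apply: n0_uniq; exists i.
Qed.

Lemma xi_rel_uniq_target (a a' : C) (s : span W a a') (n : Sub S a)
    (n' n'' : Sub S a') (e : E_hom W (sub_obj S n) (sub_obj S n'))
    (e' : E_hom W (sub_obj S n) (sub_obj S n'')) :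
  xi_rel s e -> xi_rel s e' -> n' = n''.
Proof.
move=> [p [_ mp fp]] [q [_ mq fq]]; apply: (sub_eq (svalP e) (svalP e')).
rewrite -fp -fq; congr (_ ∘ _).
by apply: (Wmono (sp_M s)); rewrite mp mq.
Qed.

Lemma xi_rel_iso (a a' : C) (s t : span W a a') (n : Sub S a) (n' : Sub S a')
    (e : E_hom W (sub_obj S n) (sub_obj S n')) :
  span_iso s t -> xi_rel s e -> xi_rel t e.
Proof.
move=> [i [iso_i [mi fi]]] [p [Mp mp fp]]; exists (i ∘ p).
by rewrite !cmpA mi fi; split=> //; apply: M_cmp Mp; apply: M_iso.
Qed.

Lemma xi_rel1 (a : C) (n : Sub S a) :
  xi_rel (id_span W a) (E_idm W (sub_obj S n)).
Proof. by exists (sub_map S n); rewrite /= !cmp1m cmpm1; split=> //; apply: sub_M. Qed.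

Lemma xi_rel_comp (a b c : C) (t : span W b c) (s : span W a b)
    (n : Sub S a) (n' : Sub S b) (n'' : Sub S c)
    (e : E_hom W (sub_obj S n) (sub_obj S n'))
    (e' : E_hom W (sub_obj S n') (sub_obj S n'')) :
  xi_rel s e -> xi_rel t e' -> xi_rel (span_comp Wpb t s) (E_comp e' e).
Proof.
move=> [p [Mp mp fp]] [q [Mq mq fq]].
have eq : sp_f s ∘ p = sp_m t ∘ (q ∘ sval e) by rewrite cmpA mq.
have [w [mw fw]] := span_comp_lift Wpb eq.
exists w; split.
- by apply: (@M_cancel _ W _ _ _ (sp_m (span_comp Wpb t s)));
    [apply: sp_M | rewrite mw mp; apply: sub_M].
- by rewrite mw.
- by rewrite fw /= !cmpA fq.
Qed.

Lemma xi_rel_decomp (a b c : C) (t : span W b c) (s : span W a b)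
    (n : Sub S a) (n'' : Sub S c)
    (d : E_hom W (sub_obj S n) (sub_obj S n'')) :
  xi_rel (span_comp Wpb t s) d ->
  exists (n' : Sub S b) (e : E_hom W (sub_obj S n) (sub_obj S n'))
    (e' : E_hom W (sub_obj S n') (sub_obj S n'')), xi_rel s e /\ xi_rel t e'.
Proof.
move=> [w [Mw mw fw]].
have [p [q [pq mp fq]]] := span_comp_elim w.
have [x [e0 [k [Ee0 [Mk ke0]]]]] := EM_factor W q.
have [n' [[i [[j [ji ij]] mi]] _]] := sub_rep S (M_cmp (sp_M t) Mk).
have Ee : Ecl W (i ∘ e0) by apply: E_cmp => //; apply: E_iso; exists j.
have Mkj : Mcl W (k ∘ j) by apply: M_cmp => //; apply: M_iso; exists i.
have mkj : sp_m t ∘ (k ∘ j) = sub_map S n' by rewrite cmpA -mi -cmpA ij cmpm1.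
have [y [e1 [l [Ee1 [Ml le1]]]]] := EM_factor W (sp_f t ∘ (k ∘ j)).
have fqE : sp_f t ∘ q = l ∘ (e1 ∘ (i ∘ e0)).
  by rewrite !cmpA le1 -!cmpA (cmpA j) ji cmp1m ke0.
have [h [[g [gh hg]] [he mh]]] :=
  EM_unique (E_cmp Ee1 Ee) Ml (svalP d) (sub_M n'') (etrans (esym fqE) (etrans fq fw)).
have Ehe1 : Ecl W (h ∘ e1) by apply: E_cmp => //; apply: E_iso; exists g.
exists n', (exist _ _ Ee), (exist _ _ Ehe1); split.
- exists p; rewrite /= mp mw; split=> //.
    by apply: (@M_cancel _ W _ _ _ (sp_m s)); [apply: sp_M | rewrite mp mw; apply: sub_M].
  by rewrite pq -ke0 !cmpA mi.
- by exists (k ∘ j); rewrite /= (cmpA (sub_map S n'')) mh le1.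
Qed.

Section Xi.
Variables (X : ab_category) (F : functor (E_category W) X).

Definition xi (a a' : C) (s : span W a a') (n : Sub S a) (n' : Sub S a') :
    F (sub_obj S n) ~> F (sub_obj S n') :=
  match pselect (exists e, @xi_rel a a' s n n' e) with
  | left h => fmap F (projT1 (cid h))
  | right _ => 0
  end.

Lemma xiE (a a' : C) (s : span W a a') (n : Sub S a) (n' : Sub S a')
    (e : E_hom W (sub_obj S n) (sub_obj S n')) :
  xi_rel s e -> xi s n n' = fmap F e.
Proof.
move=> se; rewrite /xi; case: pselect => [h|[]]; last by exists e.
by rewrite (xi_rel_uniq (projT2 (cid h)) se).
Qed.

Lemma xi0 (a a' : C) (s : span W a a') (n : Sub S a) (n' : Sub S a') :
  ~ (exists e, @xi_rel a a' s n n' e) -> xi s n n' = 0.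
Proof. by rewrite /xi; case: pselect. Qed.

Lemma xi_iso (a a' : C) (s t : span W a a') (n : Sub S a) (n' : Sub S a') :
  span_iso s t -> xi s n n' = xi t n n'.
Proof.
move=> st; have [[e se]|h] := pselect (exists e, @xi_rel a a' s n n' e).
  by rewrite (xiE se) (xiE (xi_rel_iso st se)).
rewrite !xi0 // => -[e te]; apply: h; exists e.
exact: xi_rel_iso (span_iso_sym st) te.
Qed.

Lemma xi1 (a : C) (n : Sub S a) : xi (id_span W a) n n = idm (F (sub_obj S n)).
Proof. by rewrite (xiE (xi_rel1 n)) -fmap1. Qed.

Lemma xi1_neq (a : C) (n n' : Sub S a) : n <> n' -> xi (id_span W a) n n' = 0.
Proof.
move=> nn'; apply: xi0 => -[e se].
exact: nn' (xi_rel_uniq_target (xi_rel1 n) se).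
Qed.

Lemma xi_comp (a b c : C) (t : span W b c) (s : span W a b)
    (n : Sub S a) (n'' : Sub S c) :
  \sum_n' (xi t n' n'' ∘ xi s n n') = xi (span_comp Wpb t s) n n''.
Proof.
have [[n' [e se]]|h] := pselect (exists n' e, @xi_rel a b s n n' e).
  rewrite (bigD1 n') //= big1 ?addr0 => [|k /eqP kn']; last first.
    rewrite (xi0 (n' := k)) ?cmpm0 // => -[e0 se0].
    exact: kn' (xi_rel_uniq_target se0 se).
  rewrite (xiE se).
  have [[e' te']|h] := pselect (exists e', @xi_rel b c t n' n'' e').
    by rewrite (xiE te') -fmapM (xiE (xi_rel_comp se te')).
  rewrite (xi0 h) cmp0m xi0 // => -[d /xi_rel_decomp[k [u [v [su tv]]]]].
  apply: h; have kn' := xi_rel_uniq_target su se.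
  by case: _ / kn' u v su tv {e se} => u v _ tv; exists v.
rewrite big1 => [|k _]; last first.
  by rewrite (xi0 (n' := k)) ?cmpm0 // => -[e se]; apply: h; exists k, e.
rewrite xi0 // => -[d /xi_rel_decomp[k [u [v [su _]]]]].
by apply: h; exists k, u.
Qed.

End Xi.

Variables (X : ab_category) (K : additive_karoubian X).

(* By [xi_iso], the choice of a representing span is immaterial. *)
Definition Gamma_obj (F : functor (E_category W) X) :
  functor (Par Wmono Wpb) X.
Proof.
refine (@Functor (Par Wmono Wpb) X
  (fun a => dsum K (fun n : Sub S a => F (sub_obj S n)))
  (fun a a' h => mx_hom K (xi F (par_repr h))) _ _).
- move=> a /=; apply: mx_hom1 => [n|n n' nn'].
    by rewrite (xi_iso _ _ _ (par_repr_iso _)) xi1.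
  by rewrite (xi_iso _ _ _ (par_repr_iso _)) xi1_neq.
- move=> a b c k h; rewrite mx_hom_comp; apply: mx_hom_ext => n n''.
  by rewrite xi_comp (xi_iso _ _ _ (par_repr_iso _)).
Defined.

Definition Gamma_map (F G : functor (E_category W) X) (s : nat_trans F G) :
  nat_trans (Gamma_obj F) (Gamma_obj G).
Proof.
exists (fun a => diag_hom K (fun n : Sub S a => s (sub_obj S n))) => a a' h.
rewrite /= diag_mx_hom mx_diag_hom; apply: mx_hom_ext => n n'.
have [[e se]|no_e] := pselect (exists e, @xi_rel a a' (par_repr h) n n' e).
  by rewrite !(xiE _ se) ntN.
by rewrite !(xi0 _ no_e) cmpm0 cmp0m.
Defined.

Definition Gamma : functor (functor_ab_category (E_category W) X)
  (functor_ab_category (Par Wmono Wpb) X).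
Proof.
exists Gamma_obj Gamma_map.
- by move=> F; apply: nat_trans_eq => a; apply: diag_hom1.
- by move=> F G H t s; apply: nat_trans_eq => a /=; rewrite diag_hom_comp.
Defined.

Definition covering_pairs (a : C) : finType :=
  {p : Sub S a * Sub S a | `[< covering p.1 p.2 >]}.

End Gamma.

Section Convolution.
Variables (C : category) (W : factorisation_system C) (S : subobjects W).
Variables (X : ab_category) (T : ab_algebra X).

Definition conv_unit_obj (a : C) : X :=
  if #|Sub S a| == 1%N then tunit T else zero_obj T.

Definition conv_tens_obj (F G : functor (E_category W) X) (a : C) : X :=
  dsum T (fun p : covering_pairs S a =>
    tens T (F (sub_obj S (val p).1)) (G (sub_obj S (val p).2))).

(* Only the values on objects are prescribed, not the actions on maps. *)
Definition is_convolution
    (TR : ab_algebra (functor_ab_category (E_category W) X)) : Prop :=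
  (forall a : C, (tunit TR : functor (E_category W) X) a = conv_unit_obj a) /\
  (forall (F G : functor (E_category W) X) (a : C),
    (tens TR F G : functor (E_category W) X) a = conv_tens_obj F G a).

End Convolution.

(* Main.v *)
(** Gamma is fully faithful, so any objects F * G and J of [R, X] that come with
    isomorphisms Gamma (F * G) ~ Gamma F (x) Gamma G and Gamma J ~ I receive a
    unique monoidal structure making Gamma strong monoidal, and coherence is
    inherited from the pointwise one.

    For the isomorphisms, view a total map f : A -> A' of C and the partial
    inverse of an M-map m : B -> A as maps of P. A functor H : P -> X has a core
    at A: the part killed by the restrictions to all proper M-subobjects of A.
    The core is stable under E-maps, and H is recovered as Gamma of its core,
    since H A is the direct sum of the cores at the subobjects of A. The core of
    the constant functor I is J. The core of Gamma F (x) Gamma G is F * G: a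
    pair of subobjects of A survives no proper restriction exactly when it
    covers A. *)
From mathcomp Require Import all_boot all_algebra boolp.
Require Import Defs.
Set Implicit Arguments.
Unset Strict Implicit.
Unset Printing Implicit Defensive.
Import GRing.Theory.
Local Open Scope ring_scope.
Local Open Scope cat_scope.

(** * Isomorphisms *)

Section IsoLemmas.
Variable C : category.

Lemma iso_cmp (a b c : C) (g : b ~> c) (f : a ~> b) :
  is_iso g -> is_iso f -> is_iso (g ∘ f).
Proof.
move=> [g' [g'g gg']] [f' [f'f ff']]; exists (f' ∘ g'); split.
- by rewrite -cmpA (cmpA g') g'g cmp1m.
- by rewrite -cmpA (cmpA f) ff' cmp1m.
Qed.

Lemma iso_epi (a b c : C) (f : a ~> b) (x y : b ~> c) :
  is_iso f -> x ∘ f = y ∘ f -> x = y.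
Proof.
by move=> [g [_ fg]] e; rewrite -[x]cmpm1 -[y]cmpm1 -fg !cmpA e.
Qed.

Lemma split_monic_iso (a b : C) (m : a ~> b) (g : b ~> a) :
  monic m -> m ∘ g = idm b -> is_iso m.
Proof.
by move=> mm mg; exists g; split=> //; apply: mm; rewrite cmpA mg cmp1m cmpm1.
Qed.

Lemma tensh_iso (T : monoidal C) (a b a' b' : C) (f : a ~> a') (g : b ~> b') :
  is_iso f -> is_iso g -> is_iso (tensh T f g).
Proof.
move=> [f' [f'f ff']] [g' [g'g gg']]; exists (tensh T f' g').
by rewrite -!tensM f'f ff' g'g gg' !tens1.
Qed.

End IsoLemmas.

(** * Transport of a monoidal structure along a fully faithful functor *)

Section Transport.
Variables (C D : category) (T : monoidal D) (F : functor C D).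
Hypothesis Ffull : forall (a b : C) (g : F a ~> F b), exists f, fmap F f = g.
Hypothesis Ffaith : forall (a b : C) (f f' : a ~> b),
  fmap F f = fmap F f' -> f = f'.
Variables (op : C -> C -> C) (u : C).
Variables (mu : forall a b : C, tens T (F a) (F b) ~> F (op a b)).
Variables (eta : tunit T ~> F u).
Hypotheses (mu_iso : forall a b, is_iso (mu a b)) (eta_iso : is_iso eta).

(* [f] corresponds to [g] when [F] of the domain and codomain of [f] are
   presented by the isomorphisms [N] and [N']; coherence in [C] is then read off
   from coherence in [D]. *)
Definition presents (a a' : C) (d d' : D) (N : d ~> F a) (N' : d' ~> F a')
  (f : a ~> a') (g : d ~> d') : Prop := fmap F f ∘ N = N' ∘ g.

(** Faithfulness and cancellation of the isomorphism [N] reduce an equation in [C] to its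
    counterpart in [D]; every equational axiom of the transported structure is proved this way. *)
Lemma presents_inj (a a' : C) (d d' : D) (N : d ~> F a) (N' : d' ~> F a')
    (f f' : a ~> a') (g g' : d ~> d') :
  is_iso N -> presents N N' f g -> presents N N' f' g' -> g = g' -> f = f'.
Proof.
move=> isoN e e' gg'; apply: Ffaith; apply: (iso_epi isoN).
by rewrite e e' gg'.
Qed.

Lemma presents_ex (a a' : C) (d d' : D) (N : d ~> F a) (N' : d' ~> F a')
    (g : d ~> d') : is_iso N -> exists f, presents N N' f g.
Proof.
move=> [N1 [N1N _]]; have [f fE] := Ffull (N' ∘ g ∘ N1).
by exists f; rewrite /presents fE -cmpA N1N cmpm1.
Qed.

Lemma presents_cmp (a a' a'' : C) (d d' d'' : D)
    (N : d ~> F a) (N' : d' ~> F a') (N'' : d'' ~> F a'')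
    (f' : a' ~> a'') (f : a ~> a') (g' : d' ~> d'') (g : d ~> d') :
  presents N' N'' f' g' -> presents N N' f g ->
  presents N N'' (f' ∘ f) (g' ∘ g).
Proof. by rewrite /presents => e' e; rewrite fmapM -cmpA e !cmpA e'. Qed.

Lemma presents1 (a : C) (d : D) (N : d ~> F a) :
  presents N N (idm a) (idm d).
Proof. by rewrite /presents fmap1 cmp1m cmpm1. Qed.

Lemma presents_leaf (a a' : C) (f : a ~> a') :
  presents (idm (F a)) (idm (F a')) f (fmap F f).
Proof. by rewrite /presents cmp1m cmpm1. Qed.

Lemma presents_iso (a a' : C) (d d' : D) (N : d ~> F a) (N' : d' ~> F a')
    (f : a ~> a') (g : d ~> d') :
  is_iso N -> is_iso N' -> presents N N' f g -> is_iso g -> is_iso f.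
Proof.
move=> isoN isoN' e [h [hg gh]].
have [k ke] := presents_ex N h isoN'.
exists k; split.
- apply: (presents_inj isoN (presents_cmp ke e) (presents1 N)); exact: hg.
- apply: (presents_inj isoN' (presents_cmp e ke) (presents1 N')); exact: gh.
Qed.

(** Nesting [mu_of] presents a bracketed product in [C] by the tensor product in [D] with the same
    bracketing. *)
Definition mu_of (a b : C) (d e : D) (N : d ~> F a) (M : e ~> F b) :
  tens T d e ~> F (op a b) := mu a b ∘ tensh T N M.

Lemma mu_of_iso (a b : C) (d e : D) (N : d ~> F a) (M : e ~> F b) :
  is_iso N -> is_iso M -> is_iso (mu_of N M).
Proof. by move=> iN iM; apply/iso_cmp/tensh_iso. Qed.

Definition tr_tensh (a b a' b' : C) (f : a ~> a') (g : b ~> b') :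
  op a b ~> op a' b' :=
  projT1 (cid (presents_ex (mu a' b') (tensh T (fmap F f) (fmap F g))
    (mu_iso a b))).

Lemma tr_tenshP (a b a' b' : C) (f : a ~> a') (g : b ~> b') :
  presents (mu a b) (mu a' b') (tr_tensh f g) (tensh T (fmap F f) (fmap F g)).
Proof. by rewrite /tr_tensh; case: cid. Qed.

Lemma presents_tens (a b a' b' : C) (d e d' e' : D)
    (N : d ~> F a) (M : e ~> F b) (N' : d' ~> F a') (M' : e' ~> F b')
    (f : a ~> a') (g : b ~> b') (x : d ~> d') (y : e ~> e') :
  presents N N' f x -> presents M M' g y ->
  presents (mu_of N M) (mu_of N' M') (tr_tensh f g) (tensh T x y).
Proof.
rewrite /presents /mu_of => ex ey.
by rewrite cmpA tr_tenshP -!cmpA -!tensM ex ey.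
Qed.

Let leaf (a : C) := idm (F a).
Let leaf_iso (a : C) : is_iso (leaf a) := iso_idm (F a).

Definition tr_assoc (a b c : C) : op (op a b) c ~> op a (op b c) :=
  projT1 (cid (presents_ex (mu_of (leaf a) (mu_of (leaf b) (leaf c)))
    (assoc T _ _ _)
    (mu_of_iso (mu_of_iso (leaf_iso a) (leaf_iso b)) (leaf_iso c)))).

(** [tr_assoc] is fixed by identity presentations only. Naturality of [assoc] extends this to
    arbitrary ones, which the pentagon requires because its objects are themselves products. *)
Lemma presents_assoc (a b c : C) (d e k : D)
    (N : d ~> F a) (M : e ~> F b) (P : k ~> F c) :
  presents (mu_of (mu_of N M) P) (mu_of N (mu_of M P)) (tr_assoc a b c)
    (assoc T d e k).
Proof.
rewrite /presents /tr_assoc; case: cid => f /= fP.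
have E : mu_of (mu_of N M) P =
    mu_of (mu_of (leaf a) (leaf b)) (leaf c) ∘ tensh T (tensh T N M) P.
  by rewrite /mu_of /leaf tens1 cmpm1 -!cmpA -tensM cmp1m.
rewrite E cmpA fP -cmpA assocN /mu_of /leaf tens1 cmpm1 !cmpA.
by congr (_ ∘ _); rewrite -!cmpA -tensM cmp1m.
Qed.

Definition tr_lunit (a : C) : op u a ~> a :=
  projT1 (cid (presents_ex (leaf a) (lunit T _)
    (mu_of_iso eta_iso (leaf_iso a)))).

Lemma presents_lunit (a : C) (d : D) (N : d ~> F a) :
  presents (mu_of eta N) N (tr_lunit a) (lunit T d).
Proof.
rewrite /presents /tr_lunit; case: cid => f /= fP.
have E : mu_of eta N = mu_of eta (leaf a) ∘ tensh T (idm _) N.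
  by rewrite /mu_of -cmpA -tensM cmpm1 cmp1m.
by rewrite E cmpA fP -cmpA lunitN cmp1m.
Qed.

Definition tr_runit (a : C) : op a u ~> a :=
  projT1 (cid (presents_ex (leaf a) (runit T _)
    (mu_of_iso (leaf_iso a) eta_iso))).

Lemma presents_runit (a : C) (d : D) (N : d ~> F a) :
  presents (mu_of N eta) N (tr_runit a) (runit T d).
Proof.
rewrite /presents /tr_runit; case: cid => f /= fP.
have E : mu_of N eta = mu_of (leaf a) eta ∘ tensh T N (idm _).
  by rewrite /mu_of -cmpA -tensM cmpm1 cmp1m.
by rewrite E cmpA fP -cmpA runitN cmp1m.
Qed.

Ltac isos := repeat first [exact: leaf_iso | exact: eta_iso | apply: mu_of_iso].

Definition transported : monoidal C.
Proof.
unshelve econstructor.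
- exact: op.
- exact: tr_tensh.
- exact: u.
- exact: tr_assoc.
- exact: tr_lunit.
- exact: tr_runit.
- move=> a b.
  apply: (presents_inj (mu_iso a b) (tr_tenshP _ _) (presents1 _)).
  by rewrite !fmap1 tens1.
- move=> a b a' b' a'' b'' f' g' f g.
  apply: (presents_inj (mu_iso a b) (tr_tenshP _ _)
    (presents_cmp (tr_tenshP _ _) (tr_tenshP _ _))).
  by rewrite !fmapM tensM.
- move=> a b c; apply: (presents_iso _ _
    (presents_assoc (leaf a) (leaf b) (leaf c)) (assoc_iso _ _ _ _)); isos.
- move=> a; apply: (presents_iso _ _
    (presents_lunit (leaf a)) (lunit_iso _ _)); isos.
- move=> a; apply: (presents_iso _ _
    (presents_runit (leaf a)) (runit_iso _ _)); isos.
- move=> a b c a' b' c' f g h.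
  have P := presents_leaf.
  apply: (presents_inj _
    (presents_cmp (presents_assoc (leaf a') (leaf b') (leaf c'))
      (presents_tens (presents_tens (P _ _ f) (P _ _ g)) (P _ _ h)))
    (presents_cmp
      (presents_tens (P _ _ f) (presents_tens (P _ _ g) (P _ _ h)))
      (presents_assoc (leaf a) (leaf b) (leaf c)))); first by isos.
  exact: assocN.
- move=> a b f; apply: (presents_inj _
    (presents_cmp (presents_lunit (leaf b))
       (presents_tens (presents1 eta) (presents_leaf f)))
    (presents_cmp (presents_leaf f) (presents_lunit (leaf a)))); first by isos.
  exact: lunitN.
- move=> a b f; apply: (presents_inj _
    (presents_cmp (presents_runit (leaf b))
       (presents_tens (presents_leaf f) (presents1 eta)))
    (presents_cmp (presents_leaf f) (presents_runit (leaf a)))); first by isos.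
  exact: runitN.
- move=> a b c d.
  (* A bracketed pair enters as a single factor, so the two composites in [C] are presented by the
     two sides of the pentagon in [D]. *)
  apply: (presents_inj _
    (presents_cmp
      (presents_assoc (leaf a) (leaf b) (mu_of (leaf c) (leaf d)))
      (presents_assoc (mu_of (leaf a) (leaf b)) (leaf c) (leaf d)))
    (presents_cmp
      (presents_cmp
        (presents_tens (presents1 (leaf a))
           (presents_assoc (leaf b) (leaf c) (leaf d)))
        (presents_assoc (leaf a) (mu_of (leaf b) (leaf c)) (leaf d)))
      (presents_tens (presents_assoc (leaf a) (leaf b) (leaf c))
         (presents1 (leaf d))))); first by isos.
  exact: pentagon.
- move=> a b.
  apply: (presents_inj _
    (presents_cmp
      (presents_tens (presents1 (leaf a)) (presents_lunit (leaf b)))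
      (presents_assoc (leaf a) eta (leaf b)))
    (presents_tens (presents_runit (leaf a)) (presents1 (leaf b))));
    first by isos.
  exact: triangle.
Defined.

Lemma transported_strong : strong_monoidal transported T F.
Proof.
unshelve econstructor.
- exact: mu.
- exact: eta.
- exact: mu_iso.
- exact: eta_iso.
- by move=> a b a' b' f g; rewrite -[LHS]/(mu _ _ ∘ _) -tr_tenshP.
- move=> a b c; have := presents_assoc (leaf a) (leaf b) (leaf c).
  by rewrite /presents /mu_of /leaf !tens1 !cmpm1 -!cmpA.
- move=> a; have := presents_lunit (leaf a).
  by rewrite /presents /mu_of /leaf !cmpA cmp1m.
- move=> a; have := presents_runit (leaf a).
  by rewrite /presents /mu_of /leaf !cmpA cmp1m.
Qed.

(** * Transport of a symmetry *)

Section Symmetric.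
Variable B : symmetry T.

Definition tr_braid (a b : C) : op a b ~> op b a :=
  projT1 (cid (presents_ex (mu b a) (braid B _ _) (mu_iso a b))).

Lemma presents_braid (a b : C) (d e : D) (N : d ~> F a) (M : e ~> F b) :
  presents (mu_of N M) (mu_of M N) (tr_braid a b) (braid B d e).
Proof.
rewrite /presents /tr_braid; case: cid => f /= fP.
by rewrite /mu_of cmpA fP -!cmpA braidN.
Qed.

Lemma transported_symmetry : symmetry transported.
Proof.
exists tr_braid.
- move=> a b a' b' f g; apply: (presents_inj _
    (presents_cmp (presents_braid (leaf a') (leaf b'))
      (presents_tens (presents_leaf f) (presents_leaf g)))
    (presents_cmp (presents_tens (presents_leaf g) (presents_leaf f))
      (presents_braid (leaf a) (leaf b)))); first by isos.
  exact: braidN.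
- move=> a b; apply: (presents_inj _
    (presents_cmp (presents_braid (leaf b) (leaf a))
      (presents_braid (leaf a) (leaf b))) (presents1 _)); first by isos.
  exact: braidK.
- move=> a b c; apply: (presents_inj _
    (presents_cmp
      (presents_cmp (presents_assoc (leaf b) (leaf c) (leaf a))
        (presents_braid (leaf a) (mu_of (leaf b) (leaf c))))
      (presents_assoc (leaf a) (leaf b) (leaf c)))
    (presents_cmp
      (presents_cmp
        (presents_tens (presents1 (leaf b)) (presents_braid (leaf a) (leaf c)))
        (presents_assoc (leaf b) (leaf a) (leaf c)))
      (presents_tens (presents_braid (leaf a) (leaf b)) (presents1 (leaf c)))));
    first by isos.
  exact: hexagon.
Qed.

End Symmetric.
End Transport.

(** * Total maps and restrictions *)

Section ParMaps.
Variables (C : category) (W : factorisation_system C).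
Hypotheses (Wmono : M_monic W) (Wpb : M_pullbacks W).
Local Notation P := (Par Wmono Wpb).

(** [span_class] retyped as a map of the category [P], so that composition and functors on [P] apply
    to it. *)
Definition par_map (a b : C) (s : span W a b) : @hom P a b := span_class s.

Definition tot_span (a b : C) (f : a ~> b) : span W a b :=
  @Span C W a b a (idm a) f (M_iso W (iso_idm a)).

Definition res_span (a b : C) (m : a ~> b) (Mm : Mcl W m) : span W b a :=
  @Span C W b a a m (idm a) Mm.

Definition tot (a b : C) (f : a ~> b) : @hom P a b := par_map (tot_span f).

Definition res (a b : C) (m : a ~> b) (Mm : Mcl W m) : @hom P b a :=
  par_map (res_span Mm).

Lemma par_map_eq (a b : C) (s t : span W a b) :
  span_iso s t -> par_map s = par_map t.
Proof. by move=> st; apply: (proj2 (span_classP s t)). Qed.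

Lemma par_map_comp (a b c : C) (t : span W b c) (s : span W a b) :
  par_map t ∘ par_map s = par_map (span_comp Wpb t s).
Proof. exact: par_compE. Qed.

(** The two factors are composed by a pullback of identities. Hence the action of a functor on
    partial maps is determined by total maps and restrictions. *)
Lemma par_mapE (a b : C) (s : span W a b) :
  par_map s = tot (sp_f s) ∘ res (sp_M s).
Proof.
rewrite par_map_comp; apply: par_map_eq.
apply: (span_iso_of_lifts Wmono).
- have eq : sp_f (res_span (sp_M s)) ∘ idm _ = sp_m (tot_span (sp_f s)) ∘ idm _.
    by rewrite /= cmpm1.
  have [w [mw fw]] := span_comp_lift Wpb eq; exists w.
  by rewrite mw fw /= !cmpm1.
- have [x [y [xy mx fy]]] :=
    span_comp_elim (idm (sp_obj (span_comp Wpb (tot_span (sp_f s))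
      (res_span (sp_M s))))).
  by exists x; move: mx; rewrite cmpm1.
Qed.

Lemma tot1 (a : C) : tot (idm a) = idm (a : P).
Proof.
apply: par_map_eq; exists (idm a); rewrite /= !cmpm1.
by split=> //; apply: iso_idm.
Qed.

Lemma totM (a b c : C) (g : b ~> c) (f : a ~> b) : tot (g ∘ f) = tot g ∘ tot f.
Proof.
rewrite [RHS]par_map_comp; apply: par_map_eq.
apply: (span_iso_of_lifts Wmono).
- have eq : sp_f (tot_span f) ∘ idm _ = sp_m (tot_span g) ∘ f.
    by rewrite /= cmp1m cmpm1.
  have [w [mw fw]] := span_comp_lift Wpb eq; exists w.
  by rewrite mw fw /= !cmpm1.
- have [x [y [xy mx fy]]] :=
    span_comp_elim (idm (sp_obj (span_comp Wpb (tot_span g) (tot_span f)))).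
  by exists x; move: mx; rewrite cmpm1.
Qed.

(** Base change: composing the spans on the left amounts to pulling [m] back along [f]. It moves
    restrictions past total maps. *)
Lemma res_tot (a b c r : C) (m : b ~> a) (Mm : Mcl W m) (f : c ~> a)
    (p : r ~> b) (q : r ~> c) (Mq : Mcl W q) :
  is_pullback m f p q -> res Mm ∘ tot f = tot p ∘ res Mq.
Proof.
move=> [sq univ]; rewrite -[RHS](par_mapE (Span p Mq)).
rewrite [LHS]par_map_comp; apply/par_map_eq/span_iso_sym.
apply: (span_iso_of_lifts Wmono).
- have eq : sp_f (tot_span f) ∘ q = sp_m (res_span Mm) ∘ p by [].
  have [w [mw fw]] := span_comp_lift Wpb eq; exists w.
  by rewrite mw fw /= !cmp1m.
- have [x [y [xy mx fy]]] :=
    span_comp_elim (idm (sp_obj (span_comp Wpb (res_span Mm) (tot_span f)))).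
  have [w [[pw qw] _]] := univ _ _ _ (esym xy).
  by exists w; move: mx; rewrite cmpm1 /= cmp1m => <-.
Qed.

Lemma res_iso (a b : C) (m : a ~> b) (Mm : Mcl W m) (g : b ~> a) :
  m ∘ g = idm b -> res Mm = tot g.
Proof.
move=> mg; apply: par_map_eq; apply: (span_iso_of_lifts Wmono) => /=.
- exists m; rewrite cmp1m; split=> //.
  by apply: (Wmono Mm); rewrite cmpA mg cmp1m cmpm1.
- by exists g.
Qed.

(** A monic has trivial kernel pair, so [res_tot] applies to a square with two identity legs. *)
Lemma res_totK (a b : C) (m : a ~> b) (Mm : Mcl W m) :
  res Mm ∘ tot m = idm (a : P).
Proof.
have M1 := M_iso W (iso_idm a).
rewrite (@res_tot _ _ _ _ _ Mm _ (idm a) (idm a) M1).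
  by rewrite (res_iso M1 (cmp1m (idm a))) tot1 cmp1m.
split=> // x u v uv; exists u; split; last by move=> w []; rewrite cmp1m.
by rewrite !cmp1m; split=> //; apply: (Wmono Mm).
Qed.

End ParMaps.

(** * Subobjects and coverings *)

Section Subobjects.
Variables (C : category) (W : factorisation_system C) (S : subobjects W).
Hypotheses (Wmono : M_monic W) (Wpb : M_pullbacks W).

Lemma pullback_M (a b c : C) (m : b ~> a) (f : c ~> a) : Mcl W m ->
  exists (r : C) (p : r ~> b) (q : r ~> c), is_pullback m f p q /\ Mcl W q.
Proof.
move=> Mm; have [r [p [q pb]]] := Wpb f Mm.
by exists r, p, q; split=> //; apply: M_pullback pb.
Qed.

Lemma EM_iso (a b : C) (f : a ~> b) : Ecl W f -> Mcl W f -> is_iso f.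
Proof.
move=> Ef Mf.
have [w [[wf fw] _]] : exists! w, w ∘ f = idm a /\ f ∘ w = idm b.
  by apply: EM_orthogonal Ef Mf _; rewrite cmpm1 cmp1m.
by exists w.
Qed.

(** Orthogonality of [e] and [m] provides a section of the monic [m]. *)
Lemma E_factor_M_iso (a b r : C) (e : a ~> b) (m : r ~> b) :
  Ecl W e -> Mcl W m -> factors e m -> is_iso m.
Proof.
move=> Ee Mm [u mu].
have [w [[wf mw] _]] : exists! w, w ∘ e = u /\ m ∘ w = idm b.
  by apply: EM_orthogonal Ee Mm _; rewrite mu cmp1m.
exact: split_monic_iso (Wmono Mm) mw.
Qed.

Lemma pullback_factors (a b c r x : C) (m : b ~> a) (f : c ~> a)
    (p : r ~> b) (q : r ~> c) (v : x ~> c) :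
  is_pullback m f p q -> factors (f ∘ v) m <-> factors v q.
Proof.
move=> [sq univ]; split=> [[u mu]|[w qw]].
- by have [w [[_ qw] _]] := univ _ _ _ mu; exists w.
- by exists (p ∘ w); rewrite cmpA sq -qw cmpA.
Qed.

Lemma sub_repr (a b : C) (m : b ~> a) : Mcl W m ->
  exists (n : Sub S a) (i : b ~> sub_obj S n) (j : sub_obj S n ~> b),
  [/\ j ∘ i = idm _, i ∘ j = idm _, sub_map S n ∘ i = m
    & m ∘ j = sub_map S n].
Proof.
move=> Mm; have [n [[i [[j [ji ij]] mi]] _]] := sub_rep S Mm.
by exists n, i, j; split=> //; rewrite -mi -cmpA ij cmpm1.
Qed.

Lemma sub_anti (a : C) (n n' : Sub S a) :
  factors (sub_map S n) (sub_map S n') ->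
  factors (sub_map S n') (sub_map S n) -> n = n'.
Proof.
move=> [u nu] [v n'v].
apply: (@sub_eq _ _ S _ _ _ _ (idm _) u).
- exact: E_iso (iso_idm _).
- apply: E_iso; exists v; split.
    by apply: (Wmono (sub_M n)); rewrite cmpA n'v nu cmpm1.
  by apply: (Wmono (sub_M n')); rewrite cmpA nu n'v cmpm1.
- by rewrite cmpm1.
Qed.

Lemma factors_trans (a b c d : C) (n : b ~> a) (m : c ~> a) (k : d ~> a) :
  factors n m -> factors m k -> factors n k.
Proof. by move=> [u <-] [v <-]; exists (v ∘ u); rewrite cmpA. Qed.

Lemma factors_refl (a b : C) (n : b ~> a) : factors n n.
Proof. by exists (idm _); rewrite cmpm1. Qed.

(* [c] ranges over the representatives of the subobject [sub_map S n ∘ m]. *)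
Lemma sub_minimal (a : C) (Q : Sub S a -> Prop) :
  (exists n, Q n) ->
  exists n, Q n /\ forall (b : C) (m : b ~> sub_obj S n), Mcl W m ->
    (forall c : Sub S a, factors (sub_map S n ∘ m) (sub_map S c) ->
      factors (sub_map S c) (sub_map S n ∘ m) -> Q c) -> is_iso m.
Proof.
move=> [n0 Qn0].
pose le (c n : Sub S a) := `[< factors (sub_map S c) (sub_map S n) >].
have Qn0b : `[< Q n0 >] by apply/asboolP.
(* By finiteness, [n] can be taken with the fewest subobjects below it. A subobject [c] of [n] that
   satisfies [Q] then has equally many below it, so [n] lies below [c]. *)
have [n /asboolP Qn min] := @arg_minnP _ n0 (fun n => `[< Q n >])
  (fun n => #|[pred c | le c n]|) Qn0b.
exists n; split=> // b m Mm Qc.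
have [c [i [j [ji ij ci mj]]]] := sub_repr (M_cmp (sub_M n) Mm).
have bc : factors (sub_map S n ∘ m) (sub_map S c) by exists i.
have cb : factors (sub_map S c) (sub_map S n ∘ m) by exists j.
have cn : factors (sub_map S c) (sub_map S n).
  by apply: factors_trans cb _; exists m.
have sub : [pred x | le x c] \subset [pred x | le x n].
  apply/subsetP => x; rewrite !inE => /asboolP xc; apply/asboolP.
  exact: factors_trans xc cn.
have nc : le n c.
  have : #|[pred x | le x c]| == #|[pred x | le x n]|.
    rewrite eqn_leq (subset_leq_card sub) min //.
    by apply/asboolP/Qc.
  rewrite (subset_leqif_card sub) => /subsetP/(_ n); apply.
  by apply/asboolP/factors_refl.
have {}nc : factors (sub_map S n) (sub_map S c).
  exact/asboolP.
have [w nmw] := factors_trans nc cb.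
apply: (split_monic_iso (Wmono Mm) (g := w)).
by apply: (Wmono (sub_M n)); rewrite cmpA nmw cmpm1.
Qed.

(** Pull [m] back along [e]: the pair [n], [n'] factors through the pullback, which is therefore
    invertible. So [e] factors through [m], and an E-map does so only if [m] is invertible. *)
Lemma covering_image (a a' : C) (e : a ~> a') (n n' : Sub S a)
    (k k' : Sub S a') :
  Ecl W e -> covering n n' ->
  factors (e ∘ sub_map S n) (sub_map S k) ->
  factors (e ∘ sub_map S n') (sub_map S k') -> covering k k'.
Proof.
move=> Ee cov nk n'k' b m Mm km k'm.
have [r [p [q [pb Mq]]]] := pullback_M e Mm.
have [g [gq qg]] : is_iso q.
  by apply: cov Mq _ _; apply/(pullback_factors _ pb);
    [apply: factors_trans nk km | apply: factors_trans n'k' k'm].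
apply: E_factor_M_iso Ee Mm _; exists (p ∘ g).
by have [sq _] := pb; rewrite cmpA sq -cmpA qg cmpm1.
Qed.

(** Take [b] minimal among the subobjects through which both [n] and [n'] factor. An M-map into [b]
    through which both still factor represents another such subobject, so it is invertible by
    minimality. *)
Lemma covering_exists (a : C) (n n' : Sub S a) :
  exists (b : Sub S a) (k k' : Sub S (sub_obj S b))
    (i : sub_obj S k ~> sub_obj S n) (i' : sub_obj S k' ~> sub_obj S n'),
  [/\ covering k k', is_iso i, is_iso i',
    sub_map S b ∘ sub_map S k = sub_map S n ∘ i &
    sub_map S b ∘ sub_map S k' = sub_map S n' ∘ i'].
Proof.
pose Q b := factors (sub_map S n) (sub_map S b) /\
            factors (sub_map S n') (sub_map S b).
have [|b [[[u bu] [u' bu']] min]] := @sub_minimal a Q.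
  have [t [i [j [ji ij ti tj]]]] := sub_repr (M_iso W (iso_idm a)).
  by exists t; split; [exists (i ∘ sub_map S n) | exists (i ∘ sub_map S n')];
     rewrite cmpA ti cmp1m.
have Mu : Mcl W u by apply: M_cancel (sub_M b) _; rewrite bu; apply: sub_M.
have Mu' : Mcl W u' by apply: M_cancel (sub_M b) _; rewrite bu'; apply: sub_M.
have [k [i [j [ji ij ki uj]]]] := sub_repr Mu.
have [k' [i' [j' [ji' ij' ki' uj']]]] := sub_repr Mu'.
exists b, k, k', j, j'; split.
- move=> d m Mm km k'm; apply: min Mm _ => c mc _; split.
    apply: factors_trans mc; have [w mw] := km; exists (w ∘ i).
    by rewrite -cmpA (cmpA m) mw ki.
  apply: factors_trans mc; have [w mw] := k'm; exists (w ∘ i').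
  by rewrite -cmpA (cmpA m) mw ki'.
- by exists i.
- by exists i'.
- by rewrite -bu -cmpA uj.
- by rewrite -bu' -cmpA uj'.
Qed.

(** The right-hand side says that the empty family covers [a]: the unit is to the empty family what
    the tensor is to covering pairs. *)
Lemma single_subP (a : C) :
  #|Sub S a| == 1%N <-> forall (b : C) (m : b ~> a), Mcl W m -> is_iso m.
Proof.
have [t [i [j [ji ij ti tj]]]] := sub_repr (M_iso W (iso_idm a)).
split=> [/eqP/mem_card1[t' tE] b m Mm|iso].
  have [n [i' [j' [ji' ij' ni' nj']]]] := sub_repr Mm.
  have tn : t = n.
    have := tE t; have := tE n; rewrite !inE => /esym/eqP -> /esym/eqP -> //.
  case: n / tn in i' j' ji' ij' ni' nj' *.
  rewrite -ni'; apply: iso_cmp; last by exists j'.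
  exists i; split=> //.
  by apply: (Wmono (sub_M t)); rewrite cmpA ti cmp1m cmpm1.
apply/eqP; rewrite -(card1 t); apply: eq_card => n; rewrite !inE; symmetry.
apply/eqP/sub_anti.
  by exists (i ∘ sub_map S n); rewrite cmpA ti cmp1m.
have [g [gn ng]] := iso _ _ (sub_M n).
by exists (g ∘ sub_map S t); rewrite cmpA ng cmp1m.
Qed.

(** The argument of [covering_image] for the empty family. *)
Lemma single_sub_image (a a' : C) (e : a ~> a') :
  Ecl W e -> #|Sub S a| == 1%N -> #|Sub S a'| == 1%N.
Proof.
move=> Ee /single_subP iso; apply/single_subP => b m Mm.
have [r [p [q [pb Mq]]]] := pullback_M e Mm.
have [g [gq qg]] := iso _ _ Mq.
apply: E_factor_M_iso Ee Mm _; exists (p ∘ g).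
by have [sq _] := pb; rewrite cmpA sq -cmpA qg cmpm1.
Qed.

(** The argument of [covering_exists] for the empty family: a minimal subobject, with no condition
    imposed. *)
Lemma single_sub_exists (a : C) :
  exists b : Sub S a, #|Sub S (sub_obj S b)| == 1%N.
Proof.
have [|b [_ min]] := @sub_minimal a (fun=> True).
  by have [t _] := sub_repr (M_iso W (iso_idm a)); exists t.
by exists b; apply/single_subP => d m Mm; apply: min.
Qed.

End Subobjects.

(** * Maps into and out of biproducts *)

Section Biproducts.
Variables (X : ab_category) (K : additive_karoubian X).

Lemma inj_ext (I : finType) (D : I -> X) (a : X) (x y : dsum K D ~> a) :
  (forall i, x ∘ inj K D i = y ∘ inj K D i) -> x = y.
Proof.
move=> e; rewrite -[x]cmpm1 -[y]cmpm1 -inj_proj !cmp_sumr.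
by apply: eq_bigr => i _; rewrite !cmpA e.
Qed.

Lemma proj_ext (I : finType) (D : I -> X) (a : X) (x y : a ~> dsum K D) :
  (forall i, proj K D i ∘ x = proj K D i ∘ y) -> x = y.
Proof.
move=> e; rewrite -[x]cmp1m -[y]cmp1m -inj_proj !cmp_suml.
by apply: eq_bigr => i _; rewrite -!cmpA e.
Qed.

Definition copair (I : finType) (D : I -> X) (a : X) (u : forall i, D i ~> a) :
  dsum K D ~> a := \sum_i (u i ∘ proj K D i).

Lemma copair_inj (I : finType) (D : I -> X) (a : X) (u : forall i, D i ~> a) i :
  copair u ∘ inj K D i = u i.
Proof.
rewrite /copair cmp_suml (bigD1 i) //= big1 ?addr0 => [|j /eqP ji].
  by rewrite -cmpA proj_injE cmpm1.
by rewrite -cmpA proj_inj0 ?cmpm0 // => ij; apply: ji.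
Qed.

Definition pair (I : finType) (D : I -> X) (a : X) (u : forall i, a ~> D i) :
  a ~> dsum K D := \sum_i (inj K D i ∘ u i).

Lemma proj_pair (I : finType) (D : I -> X) (a : X) (u : forall i, a ~> D i) i :
  proj K D i ∘ pair u = u i.
Proof.
rewrite /pair cmp_sumr (bigD1 i) //= big1 ?addr0 => [|j /eqP ji].
  by rewrite cmpA proj_injE cmp1m.
by rewrite cmpA proj_inj0 ?cmp0m.
Qed.

Lemma mx_hom_inj (I J : finType) (D : I -> X) (D' : J -> X)
    (u : forall i j, D i ~> D' j) i :
  mx_hom K u ∘ inj K D i = \sum_j (inj K D' j ∘ u i j).
Proof.
have -> : mx_hom K u = copair (fun i => \sum_j (inj K D' j ∘ u i j)).
  by apply: eq_bigr => k _; rewrite cmp_suml.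
exact: copair_inj.
Qed.

Lemma diag_hom_inj (I : finType) (D D' : I -> X)
    (u : forall i, D i ~> D' i) i :
  diag_hom K u ∘ inj K D i = inj K D' i ∘ u i.
Proof.
have -> : diag_hom K u = copair (fun i => inj K D' i ∘ u i) by [].
exact: copair_inj.
Qed.

Lemma zero_obj_idm : idm (zero_obj K) = 0.
Proof. by apply: inj_ext; case. Qed.

End Biproducts.

(** * The action of Gamma on summands *)

Section GammaMaps.
Variables (C : category) (W : factorisation_system C).
Hypotheses (Wmono : M_monic W) (Wpb : M_pullbacks W).
Variables (S : subobjects W) (X : ab_category) (K : additive_karoubian X).
Local Notation R := (E_category W).
Local Notation P := (Par Wmono Wpb).
Local Notation GammaO := (Gamma_obj Wmono Wpb S K).
Local Notation tot := (tot Wmono Wpb).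
Local Notation res := (res Wmono Wpb).
Local Notation par_map := (par_map Wmono Wpb).

(** The biproduct inclusions, retyped so that their composites with maps of [GammaO F] match in
    rewriting. *)
Definition Gamma_in (F : functor R X) (a : C) (n : Sub S a) :
  F (sub_obj S n) ~> GammaO F a := inj K (fun k => F (sub_obj S k)) n.
Definition Gamma_out (F : functor R X) (a : C) (n : Sub S a) :
  GammaO F a ~> F (sub_obj S n) := proj K (fun k => F (sub_obj S k)) n.

Lemma Gamma_outK (F : functor R X) (a : C) (n : Sub S a) :
  Gamma_out F n ∘ Gamma_in F n = idm _.
Proof. exact: proj_injE. Qed.

Lemma Gamma_out_in0 (F : functor R X) (a : C) (n n' : Sub S a) :
  n <> n' -> Gamma_out F n' ∘ Gamma_in F n = 0.
Proof. exact: proj_inj0. Qed.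

Lemma Gamma_in_ext (F : functor R X) (a : C) (x : X) (y z : GammaO F a ~> x) :
  (forall n, y ∘ Gamma_in F n = z ∘ Gamma_in F n) -> y = z.
Proof. exact: inj_ext. Qed.

Lemma Gamma_out_ext (F : functor R X) (a : C) (x : X) (y z : x ~> GammaO F a) :
  (forall n, Gamma_out F n ∘ y = Gamma_out F n ∘ z) -> y = z.
Proof. exact: proj_ext. Qed.

Lemma Gamma_map_in (F G : functor R X) (s : nat_trans F G) (a : C)
    (n : Sub S a) :
  Gamma_map Wmono Wpb S K s a ∘ Gamma_in F n = Gamma_in G n ∘ s (sub_obj S n).
Proof. exact: diag_hom_inj. Qed.

Lemma xi_relE (a a' : C) (s : span W a a') (n : Sub S a) (n' : Sub S a')
    (p : sub_obj S n ~> sp_obj s) (e : E_hom W (sub_obj S n) (sub_obj S n')) :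
  sp_m s ∘ p = sub_map S n -> sp_f s ∘ p = sub_map S n' ∘ sval e ->
  xi_rel s e.
Proof.
move=> mp fp; exists p; split=> //.
by apply: M_cancel (sp_M s) _; rewrite mp; apply: sub_M.
Qed.

(** [n'] represents the image of [sp_f s ∘ p]. *)
Lemma xi_rel_exists (a a' : C) (s : span W a a') (n : Sub S a)
    (p : sub_obj S n ~> sp_obj s) :
  sp_m s ∘ p = sub_map S n ->
  exists n' (e : E_hom W (sub_obj S n) (sub_obj S n')), xi_rel s e.
Proof.
move=> mp; have [r [e [m [Ee [Mm me]]]]] := EM_factor W (sp_f s ∘ p).
have [n' [i [j [ji ij ni mj]]]] := sub_repr S Mm.
have Eie : Ecl W (i ∘ e) by apply: E_cmp Ee; apply: E_iso; exists j.
exists n', (exist _ _ Eie); apply: xi_relE mp _.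
by rewrite /= cmpA ni me.
Qed.

(** [n'] is determined by [s] and [n], so only one matrix entry out of the summand [n] can be
    nonzero. *)
Lemma Gamma_map_par (F : functor R X) (a a' : C) (s : span W a a') (n : Sub S a)
    (n' : Sub S a') (e : E_hom W (sub_obj S n) (sub_obj S n')) :
  xi_rel s e ->
  fmap (GammaO F) (par_map s) ∘ Gamma_in F n = Gamma_in F n' ∘ fmap F e.
Proof.
move=> se; rewrite [LHS]mx_hom_inj.
rewrite (bigD1 n') //= big1 ?addr0 => [|k /eqP kn']; last first.
  rewrite (xi_iso Wmono _ _ _ (par_repr_iso _)) xi0 ?cmpm0 // => -[d sd].
  exact: kn' (xi_rel_uniq_target Wmono sd se).
by rewrite (xi_iso Wmono _ _ _ (par_repr_iso _)) (xiE Wmono _ se).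
Qed.

Lemma Gamma_map_par0 (F : functor R X) (a a' : C) (s : span W a a')
    (n : Sub S a) :
  ~ factors (sub_map S n) (sp_m s) ->
  fmap (GammaO F) (par_map s) ∘ Gamma_in F n = 0.
Proof.
move=> nf; rewrite [LHS]mx_hom_inj big1 // => k _.
rewrite (xi_iso Wmono _ _ _ (par_repr_iso _)) xi0 ?cmpm0 //.
by move=> [d [p [_ mp _]]]; apply: nf; exists p.
Qed.

Lemma Gamma_tot (F : functor R X) (a a' : C) (f : a ~> a') (n : Sub S a)
    (n' : Sub S a') (e : E_hom W (sub_obj S n) (sub_obj S n')) :
  f ∘ sub_map S n = sub_map S n' ∘ sval e ->
  fmap (GammaO F) (tot f) ∘ Gamma_in F n = Gamma_in F n' ∘ fmap F e.
Proof.
move=> fe; apply: Gamma_map_par.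
by apply: (@xi_relE _ _ (tot_span W f) _ _ _ _ (cmp1m _)).
Qed.

Lemma tot_image (a a' : C) (f : a ~> a') (n : Sub S a) :
  exists n' (e : E_hom W (sub_obj S n) (sub_obj S n')),
    f ∘ sub_map S n = sub_map S n' ∘ sval e.
Proof.
have [n' [e [p [_ /= mp fp]]]] :=
  @xi_rel_exists _ _ (tot_span W f) n _ (cmp1m _).
by exists n', e; rewrite -fp -mp cmp1m.
Qed.

Lemma Gamma_res0 (F : functor R X) (a b : C) (m : b ~> a) (Mm : Mcl W m)
    (n : Sub S a) :
  ~ factors (sub_map S n) m -> fmap (GammaO F) (res Mm) ∘ Gamma_in F n = 0.
Proof. exact: (@Gamma_map_par0 _ _ _ (res_span Mm)). Qed.

End GammaMaps.

(** * Full faithfulness of Gamma *)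

Section GammaFullyFaithful.
Variables (C : category) (W : factorisation_system C).
Hypotheses (Wmono : M_monic W) (Wpb : M_pullbacks W).
Variables (S : subobjects W) (X : ab_category) (K : additive_karoubian X).
Local Notation R := (E_category W).
Local Notation P := (Par Wmono Wpb).
Local Notation GammaO := (Gamma_obj Wmono Wpb S K).
Local Notation tot := (tot Wmono Wpb).
Local Notation res := (res Wmono Wpb).
Local Notation Gamma_in := (Gamma_in Wmono Wpb K).
Local Notation Gamma_out := (Gamma_out Wmono Wpb K).

(* [top a] is the representative of the identity of [a]; it need not be the
   identity itself. *)
Lemma top_exists (a : C) :
  exists (t : Sub S a), exists i : a ~> sub_obj S t,
    i ∘ sub_map S t = idm _ /\ sub_map S t ∘ i = idm _.
Proof.
have [t [i [j [ji ij ti tj]]]] := sub_repr S (M_iso W (iso_idm a)).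
by exists t, i; split=> //; rewrite -ij -tj cmp1m.
Qed.

Definition top (a : C) : Sub S a := projT1 (cid (top_exists a)).
Definition to_top (a : C) : a ~> sub_obj S (top a) :=
  projT1 (cid (projT2 (cid (top_exists a)))).

Lemma to_topP (a : C) :
  to_top a ∘ sub_map S (top a) = idm _ /\ sub_map S (top a) ∘ to_top a = idm _.
Proof. exact: projT2 (cid (projT2 (cid (top_exists a)))). Qed.

Lemma top_iso (a : C) : is_iso (sub_map S (top a)).
Proof. by exists (to_top a); apply: to_topP. Qed.

Lemma to_top_iso (a : C) : is_iso (to_top a).
Proof. by exists (sub_map S (top a)); have [] := to_topP a. Qed.

Definition topE (a : C) : @hom R (sub_obj S (top a)) a :=
  exist _ _ (E_iso W (top_iso a)).
Definition to_topE (a : C) : @hom R a (sub_obj S (top a)) :=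
  exist _ _ (E_iso W (to_top_iso a)).

Lemma topEK (a : C) : topE a ∘ to_topE a = idm (a : R).
Proof. by apply: E_hom_eq; have [] := to_topP a. Qed.

Lemma to_topEK (a : C) : to_topE a ∘ topE a = idm (sub_obj S (top a) : R).
Proof. by apply: E_hom_eq; have [] := to_topP a. Qed.

Lemma iso_top (a : C) (n : Sub S a) : is_iso (sub_map S n) -> n = top a.
Proof.
move=> [g [gn ng]]; have [jt tj] := to_topP a; apply: sub_anti => //.
  by exists (to_top a ∘ sub_map S n); rewrite cmpA tj cmp1m.
by exists (g ∘ sub_map S (top a)); rewrite cmpA ng cmp1m.
Qed.

(** The core of [Gamma F] at [a] is the summand at [top a], identified with [F a] through the
    isomorphism between [a] and its representative. *)
Definition core_in (F : functor R X) (a : C) : F a ~> GammaO F a :=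
  Gamma_in F (top a) ∘ fmap F (to_topE a).
Definition core_out (F : functor R X) (a : C) : GammaO F a ~> F a :=
  fmap F (topE a) ∘ Gamma_out F (top a).

Lemma coreK (F : functor R X) (a : C) : core_out F a ∘ core_in F a = idm (F a).
Proof.
rewrite /core_out /core_in -cmpA (cmpA (Gamma_out _ _)) Gamma_outK cmp1m.
rewrite -fmapM topEK.
exact: fmap1.
Qed.

Lemma core_in_mono (F : functor R X) (a : C) (x : X) (y z : x ~> F a) :
  core_in F a ∘ y = core_in F a ∘ z -> y = z.
Proof.
by move=> e; rewrite -[y]cmp1m -[z]cmp1m -(coreK F a) -!(cmpA (core_out F a)) e.
Qed.

Lemma tot_core (F : functor R X) (a a' : C) (f : a ~> a') (n : Sub S a')
    (e : @hom R a (sub_obj S n)) :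
  f = sub_map S n ∘ sval e ->
  fmap (GammaO F) (tot f) ∘ core_in F a = Gamma_in F n ∘ fmap F e.
Proof.
move=> fe; rewrite /core_in cmpA.
rewrite (@Gamma_tot _ _ Wmono Wpb S _ K F _ _ f (top a) n (e ∘ topE a)).
  by rewrite fmapM -!cmpA -fmapM topEK fmap1 cmpm1.
by rewrite /= cmpA fe.
Qed.

(** Each summand is thus the core at a subobject, carried along a total map; hence the cores
    generate [Gamma F]. *)
Lemma tot_core_sub (F : functor R X) (a : C) (n : Sub S a) :
  fmap (GammaO F) (tot (sub_map S n)) ∘ core_in F (sub_obj S n) = Gamma_in F n.
Proof.
rewrite (@tot_core F _ _ _ n (@idm R _)) ?cmpm1 //.
by rewrite (fmap1 F) cmpm1.
Qed.

Lemma tot_core_E (F : functor R X) (a a' : C) (e : @hom R a a') :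
  fmap (GammaO F) (tot (sval e)) ∘ core_in F a = core_in F a' ∘ fmap F e.
Proof.
rewrite (@tot_core F _ _ _ (top a') (to_topE a' ∘ e)); last first.
  by have [_ tj] := to_topP a'; rewrite /= cmpA tj cmp1m.
by rewrite fmapM /core_in cmpA.
Qed.

Lemma res_core0 (F : functor R X) (a b : C) (m : b ~> a) (Mm : Mcl W m) :
  ~ is_iso m -> fmap (GammaO F) (res Mm) ∘ core_in F a = 0.
Proof.
move=> niso; rewrite /core_in cmpA Gamma_res0 ?cmp0m // => -[u mu].
apply: niso; apply: (split_monic_iso (Wmono Mm) (g := u ∘ to_top a)).
by rewrite cmpA mu; have [] := to_topP a.
Qed.

(** Dual to [tot_core_sub], and checked on each summand [k]. If [k] is not below [n], the
    restriction vanishes; if it is strictly below, its image in [n] is not the top, so the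
    projection to the core vanishes. *)
Lemma core_res (F : functor R X) (a : C) (n : Sub S a) :
  core_out F (sub_obj S n) ∘ fmap (GammaO F) (res (sub_M n)) = Gamma_out F n.
Proof.
apply: Gamma_in_ext => k.
have [->|kn] := EM (k = n).
  by rewrite Gamma_outK -cmpA -tot_core_sub
    (cmpA (fmap (GammaO F) (res _))) -fmapM
    res_totK fmap1 cmp1m coreK.
rewrite Gamma_out_in0 // -cmpA.
have [[p np]|nf] := EM (factors (sub_map S k) (sub_map S n)); last first.
  by rewrite Gamma_res0 ?cmpm0.
have Mp : Mcl W p by apply: M_cancel (sub_M n) _; rewrite np; apply: sub_M.
rewrite -tot_core_sub (cmpA (fmap (GammaO F) (res _))) -fmapM -np totM.
rewrite (cmpA (res _)) res_totK cmp1m.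
have [l [e le]] := tot_image p (top _).
rewrite (@tot_core F _ _ p l (@cmp R _ _ _ e (to_topE _))); last first.
  by have [_ tj] := to_topP (sub_obj S k); rewrite /= cmpA -le -cmpA tj cmpm1.
rewrite /core_out -cmpA (cmpA (Gamma_out _ _)).
have [lt|lt] := EM (l = top _); last by rewrite Gamma_out_in0 // cmp0m cmpm0.
(* If the image of the M-map [p] is the top, then [p] is also an E-map, hence invertible, and
   [k = n]. *)
case: kn; have [g [gp pg]] : is_iso p.
  apply: EM_iso Mp; rewrite -[p]cmpm1; have [_ <-] := to_topP (sub_obj S k).
  rewrite cmpA le; apply: E_cmp; last by apply/E_iso/to_top_iso.
  apply: E_cmp (svalP e); apply: E_iso; rewrite lt; exact: top_iso.
apply: (@sub_anti _ _ _ Wmono); first by exists p.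
by exists g; rewrite -np -cmpA pg cmpm1.
Qed.

(* The image of [core_in F a] is the part of [Gamma F a] killed by all proper
   restrictions. *)
Lemma core_lift (F : functor R X) (a : C) (x : X) (y : x ~> GammaO F a) :
  (forall (b : C) (m : b ~> a) (Mm : Mcl W m), ~ is_iso m ->
    fmap (GammaO F) (res Mm) ∘ y = 0) ->
  core_in F a ∘ (core_out F a ∘ y) = y.
Proof.
move=> y0; apply: Gamma_out_ext => n.
have -> : core_in F a ∘ (core_out F a ∘ y) =
    Gamma_in F (top a) ∘ (Gamma_out F (top a) ∘ y).
  rewrite /core_in /core_out -!cmpA; congr (_ ∘ _).
  by rewrite (cmpA (fmap F _) (fmap F _)) -fmapM to_topEK fmap1 cmp1m.
have [->|nt] := EM (n = top a); first by rewrite cmpA Gamma_outK cmp1m.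
rewrite cmpA Gamma_out_in0 ?cmp0m; last by move=> tn; apply: nt.
(* By [core_res], the component at [n] factors through a restriction, which is proper because [n] is
   not the top. *)
rewrite -core_res -cmpA y0 ?cmpm0 // => /iso_top; exact: nt.
Qed.

Local Notation GammaF := (Gamma Wmono Wpb S K).

Lemma Gamma_map_core (F G : functor R X) (s : nat_trans F G) (a : C) :
  Gamma_map Wmono Wpb S K s a ∘ core_in F a = core_in G a ∘ s a.
Proof. by rewrite /core_in cmpA /= Gamma_map_in -!cmpA ntN. Qed.

Lemma Gamma_mapK (F G : functor R X) (s : nat_trans F G) (a : C) :
  core_out G a ∘ (Gamma_map Wmono Wpb S K s a ∘ core_in F a) = s a.
Proof. by rewrite Gamma_map_core cmpA coreK cmp1m. Qed.

Lemma Gamma_faithful (F G : functor_ab_category R X) (s t : F ~> G) :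
  fmap GammaF s = fmap GammaF t -> s = t.
Proof.
move=> st; apply: nat_trans_eq => a; rewrite -Gamma_mapK -[RHS]Gamma_mapK.
by rewrite [Gamma_map _ _ _ _ s]st.
Qed.

(** By naturality at restrictions, [t] preserves the part killed by proper ones, so it induces a map
    [s] of cores; naturality at total maps then forces [t] on all summands. *)
Lemma Gamma_map_full (F G : functor R X)
  (t : nat_trans (GammaO F) (GammaO G)) :
  exists s : nat_trans F G, Gamma_map Wmono Wpb S K s = t.
Proof.
pose s (a : C) : F a ~> G a := core_out G a ∘ (t a ∘ core_in F a).
have sE a : core_in G a ∘ s a = t a ∘ core_in F a.
  apply: core_lift => b m Mm niso.
  by rewrite cmpA -ntN -cmpA res_core0 ?cmpm0.
have sN (a b : R) (f : a ~> b) : s b ∘ fmap F f = fmap G f ∘ s a.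
  apply: core_in_mono; rewrite (cmpA (core_in G b)) sE.
  rewrite -(cmpA _ (core_in F b)) -tot_core_E (cmpA (t b)) ntN.
  by rewrite -(cmpA _ (t a)) -sE (cmpA _ (core_in G a)) tot_core_E -cmpA.
exists (NatTrans sN); apply: nat_trans_eq => a; apply: Gamma_in_ext => n.
rewrite Gamma_map_in -!tot_core_sub (cmpA (t a)) ntN.
rewrite -(cmpA _ (core_in G _)) -(cmpA _ (t _)); congr (_ ∘ _).
exact: sE.
Qed.

Lemma Gamma_full (F G : functor_ab_category R X) (t : GammaF F ~> GammaF G) :
  exists s : F ~> G, fmap GammaF s = t.
Proof. exact: (@Gamma_map_full F G t). Qed.

Lemma Gamma_additive (F G : functor_ab_category R X) (s t : F ~> G) :
  fmap GammaF (s + t) = fmap GammaF s + fmap GammaF t.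
Proof.
apply: nat_trans_eq => a; apply: Gamma_in_ext => n.
rewrite [LHS]Gamma_map_in [RHS]cmpDl /= !Gamma_map_in.
exact: cmpDr.
Qed.

End GammaFullyFaithful.

(** * Functors on partial maps recovered from their core *)

Section Decomposition.
Variables (C : category) (W : factorisation_system C).
Hypotheses (Wmono : M_monic W) (Wpb : M_pullbacks W).
Variables (S : subobjects W) (X : ab_category) (K : additive_karoubian X).
Local Notation R := (E_category W).
Local Notation P := (Par Wmono Wpb).
Local Notation GammaO := (Gamma_obj Wmono Wpb S K).
Local Notation tot := (tot Wmono Wpb).
Local Notation res := (res Wmono Wpb).
Local Notation par_map := (par_map Wmono Wpb).
Local Notation Gamma_in := (Gamma_in Wmono Wpb K).
Local Notation Gamma_out := (Gamma_out Wmono Wpb K).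

(** Axioms for a core [L] of [H], given as a retract so that lying in the core means being fixed by
    [inc ∘ ret]. [ret_tot] separates the core from what comes from proper subobjects; by [inc_ext]
    the cores at the subobjects of [a] generate [H a]. *)
Variables (H : functor P X) (L : C -> X).
Variables (inc : forall a : C, L a ~> H a) (ret : forall a : C, H a ~> L a).
Hypotheses
  (retK : forall a, ret a ∘ inc a = idm (L a))
  (inc_E : forall (a a' : C) (e : a ~> a'), Ecl W e ->
    inc a' ∘ (ret a' ∘ (fmap H (tot e) ∘ inc a)) = fmap H (tot e) ∘ inc a)
  (inc_res : forall (a b : C) (m : b ~> a) (Mm : Mcl W m), ~ is_iso m ->
    fmap H (res Mm) ∘ inc a = 0)
  (ret_tot : forall (a b : C) (m : b ~> a), Mcl W m -> ~ is_iso m ->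
    ret a ∘ fmap H (tot m) = 0)
  (inc_ext : forall (a : C) (x : X) (y z : H a ~> x),
    (forall n : Sub S a, y ∘ (fmap H (tot (sub_map S n)) ∘ inc (sub_obj S n)) =
      z ∘ (fmap H (tot (sub_map S n)) ∘ inc (sub_obj S n))) -> y = z).

Definition core_functor : functor R X.
Proof.
exists (L : R -> X)
  (fun a b e => ret b ∘ (fmap H (tot (sval e)) ∘ inc a)).
- by move=> a; rewrite [sval _]/(idm _) tot1 fmap1 cmp1m retK.
- move=> a b c g f; rewrite [sval _]/(sval g ∘ sval f) totM fmapM.
  (* A composite of two values has the idempotent [inc ∘ ret] in the middle; stability of the core
     under E-maps inserts it. *)
  rewrite -(cmpA (fmap H _) (fmap H _)) -[in LHS](inc_E (svalP f)).
  by rewrite !cmpA.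
Defined.

Lemma inc_core (a a' : C) (e : @hom R a a') :
  inc a' ∘ fmap core_functor e = fmap H (tot (sval e)) ∘ inc a.
Proof. exact: inc_E (svalP e). Qed.

Definition recompose_map (a : C) : GammaO core_functor a ~> H a :=
  copair K (fun n : Sub S a =>
    fmap H (tot (sub_map S n)) ∘ inc (sub_obj S n)).

Lemma recompose_in (a : C) (n : Sub S a) :
  recompose_map a ∘ Gamma_in core_functor n =
  fmap H (tot (sub_map S n)) ∘ inc (sub_obj S n).
Proof. exact: copair_inj. Qed.

Lemma par_map_tot (a a' r : C) (s : span W a a') (p : r ~> sp_obj s) :
  par_map s ∘ tot (sp_m s ∘ p) = tot (sp_f s ∘ p).
Proof.
rewrite par_mapE totM -cmpA (cmpA (res _)).
by rewrite (res_totK Wmono Wpb (sp_M s)) cmp1m -totM.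
Qed.

(** Checked on each summand [n]: if [n] lies in the domain of [h], both sides follow the image of
    [n]; otherwise both vanish. *)
Lemma recompose_natural (a a' : C) (h : @hom P a a') :
  recompose_map a' ∘ fmap (GammaO core_functor) h =
  fmap H h ∘ recompose_map a.
Proof.
elim/par_homP: h => s; rewrite -[span_class s]/(par_map s).
apply: Gamma_in_ext => n.
rewrite -(cmpA (fmap H _)) recompose_in -(cmpA (recompose_map _)).
have [[p mp]|nf] := EM (factors (sub_map S n) (sp_m s)).
  have [n' [e se]] := xi_rel_exists mp.
  have [q [_ mq fq]] := se.
  have fp : sp_f s ∘ p = sub_map S n' ∘ sval e.
    by rewrite -fq; congr (_ ∘ _); apply: (Wmono (sp_M s)); rewrite mp mq.
  rewrite (Gamma_map_par Wmono Wpb K core_functor se) cmpA recompose_in.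
  rewrite -cmpA inc_core cmpA -fmapM -totM -fp.
  by rewrite [RHS]cmpA -fmapM -mp par_map_tot.
rewrite Gamma_map_par0 // cmpm0 cmpA -fmapM par_mapE -cmpA.
(* The intersection of [n] with the domain of [s] is proper in [n], so restricting to it kills the
   core. *)
have [r [p [q [pb Mq]]]] := pullback_M Wpb (sub_map S n) (sp_M s).
rewrite (res_tot _ _ _ Mq pb) cmpA -totM fmapM -cmpA inc_res ?cmpm0 //.
move=> [g [gq qg]]; apply: nf; exists (p ∘ g).
by have [sq _] := pb; rewrite cmpA sq -cmpA qg cmpm1.
Qed.

Definition recompose : nat_trans (GammaO core_functor) H :=
  @NatTrans P X _ _ recompose_map recompose_natural.

Lemma recompose_iso : @is_iso (functor_category P X) _ _ recompose.
Proof.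
apply: pt_iso => a; rewrite [recompose a]/(recompose_map a).
(* The inverse restricts to each subobject and projects to the core there. *)
pose M : H a ~> GammaO core_functor a := pair K (fun n : Sub S a =>
  ret (sub_obj S n) ∘ fmap H (res (sub_M n))).
have prM n : Gamma_out core_functor n ∘ M =
    ret (sub_obj S n) ∘ fmap H (res (sub_M n)).
  exact: proj_pair.
have MN : M ∘ recompose_map a = idm _.
  apply: Gamma_in_ext => k; apply: Gamma_out_ext => n.
  rewrite -(cmpA M) recompose_in cmp1m (cmpA _ M) prM.
  rewrite -(cmpA (ret _)) (cmpA (fmap H _) (fmap H _)) -fmapM.
  have [<-|kn] := EM (k = n).
    by rewrite res_totK fmap1 cmp1m retK Gamma_outK.
  rewrite Gamma_out_in0 //.
  (* Off the diagonal, base change goes through the intersection of [k] and [n]. If it is proper in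
     [k], [inc_res] gives zero; otherwise [k] is strictly below [n] and [ret_tot] gives zero. *)
  have [r [p [q [pb Mq]]]] := pullback_M Wpb (sub_map S k) (sub_M n).
  rewrite (res_tot _ _ _ Mq pb).
  have [[g [gq qg]]|niso] := EM (is_iso q); last first.
    by rewrite fmapM -cmpA inc_res // !cmpm0.
  rewrite (res_iso _ _ _ qg) -totM.
  have npg : sub_map S n ∘ (p ∘ g) = sub_map S k.
    by have [sq _] := pb; rewrite cmpA sq -cmpA qg cmpm1.
  have Mpg : Mcl W (p ∘ g).
    by apply: M_cancel (sub_M n) _; rewrite npg; apply: sub_M.
  rewrite cmpA ret_tot ?cmp0m // => -[h [hp ph]]; apply: kn.
  apply: (@sub_anti _ _ _ Wmono); first by exists (p ∘ g).
  by exists h; rewrite -npg -cmpA ph cmpm1.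
(* By [inc_ext] the map [recompose_map a] is epic, so its left inverse is two-sided. *)
exists M; split=> //; apply: inc_ext => n.
rewrite -recompose_in -!cmpA cmp1m; congr (_ ∘ _).
by rewrite cmpA MN cmp1m.
Qed.

End Decomposition.

(** * Biproducts and splittings in functor categories *)

Section FunctorAdditiveKaroubian.
Variables (D : category) (X : ab_category) (K : additive_karoubian X).
Local Notation FX := (functor_ab_category D X).

Lemma nt_sum (F G : functor D X) (I : finType) (s : I -> nat_trans F G)
    (a : D) :
  (\sum_i s i) a = \sum_i s i a.
Proof. by apply: (big_morph (fun t : nat_trans F G => t a)). Qed.

Definition functor_dsum (I : finType) (F : I -> functor D X) : functor D X.
Proof.
exists (fun a => dsum K (fun i => F i a))
  (fun a b f => diag_hom K (fun i => fmap (F i) f)).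
- move=> a; rewrite -diag_hom1; apply: eq_bigr => i _.
  by rewrite fmap1.
- move=> a b c g f; rewrite diag_hom_comp; apply: eq_bigr => i _.
  by rewrite fmapM.
Defined.

Definition functor_inj (I : finType) (F : I -> functor D X) (i : I) :
  nat_trans (F i) (functor_dsum F).
Proof.
exists (fun a => inj K (fun i => F i a) i) => a b f /=.
by rewrite diag_hom_inj.
Defined.

Definition functor_proj (I : finType) (F : I -> functor D X) (i : I) :
  nat_trans (functor_dsum F) (F i).
Proof.
exists (fun a => proj K (fun i => F i a) i) => a b f /=.
apply: inj_ext => j; rewrite -!cmpA diag_hom_inj.
have [<-|ji] := EM (j = i); first by rewrite cmpA !proj_injE cmp1m cmpm1.
by rewrite cmpA !proj_inj0 // cmp0m cmpm0.
Defined.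

(** Split [e] at each object and let [G] act by conjugating [F] with the splittings; naturality of
    [e] makes this functorial. *)
Lemma functor_idempotents_split (F : functor D X) (e : nat_trans F F) :
  nt_cmp e e = e ->
  exists (G : functor D X) (r : nat_trans F G) (s : nat_trans G F),
    nt_cmp r s = nt_id G /\ nt_cmp s r = e.
Proof.
move=> ee.
have ea a : e a ∘ e a = e a by have := congr1 (fun t : nat_trans F F => t a) ee.
(* The splitting object and its two maps are packed together so that one choice at each [a] yields
   all three. *)
pose Q a (z : {b : X & ((F a ~> b) * (b ~> F a))%type}) :=
  (projT2 z).1 ∘ (projT2 z).2 = idm _ /\ (projT2 z).2 ∘ (projT2 z).1 = e a.
have zex a : exists z, Q a z.
  have [b [r [s rs]]] := idempotents_split K (ea a).
  by exists (existT _ b (r, s)).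
pose z a := projT1 (cid (zex a)).
pose r a : F a ~> projT1 (z a) := (projT2 (z a)).1.
pose s a : projT1 (z a) ~> F a := (projT2 (z a)).2.
have rs a : r a ∘ s a = idm _ by have [] := projT2 (cid (zex a)).
have sr a : s a ∘ r a = e a by have [] := projT2 (cid (zex a)).
have re a : r a ∘ e a = r a by rewrite -sr cmpA rs cmp1m.
have es a : e a ∘ s a = s a by rewrite -sr -cmpA rs cmpm1.
have G1 a : r a ∘ fmap F (idm a) ∘ s a = idm _ by rewrite fmap1 cmpm1 rs.
have GM a b c (g : b ~> c) (f : a ~> b) : r c ∘ fmap F (g ∘ f) ∘ s a =
    r c ∘ fmap F g ∘ s b ∘ (r b ∘ fmap F f ∘ s a).
  rewrite !cmpA -(cmpA _ (s b)) sr -(cmpA _ (fmap F g)) -ntN cmpA re.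
  by rewrite fmapM !cmpA.
pose G := @Functor D X (fun a => projT1 (z a))
  (fun a b f => r b ∘ fmap F f ∘ s a) G1 GM.
have rN a b (f : a ~> b) : r b ∘ fmap F f = fmap G f ∘ r a.
  by rewrite [fmap G f]/(_ ∘ _ ∘ _) -!cmpA sr -ntN cmpA re.
have sN a b (f : a ~> b) : s b ∘ fmap G f = fmap F f ∘ s a.
  by rewrite [fmap G f]/(_ ∘ _ ∘ _) !cmpA sr ntN -cmpA es.
exists G, (@NatTrans D X F G r rN), (@NatTrans D X G F s sN).
by split; apply: nat_trans_eq => a; [apply: rs | apply: sr].
Qed.

Definition functor_additive_karoubian : additive_karoubian FX.
Proof.
unshelve econstructor.
- exact: functor_dsum.
- exact: functor_inj.
- exact: functor_proj.
- by move=> I F i; apply: nat_trans_eq => a; apply: proj_injE.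
- by move=> I F i j ij; apply: nat_trans_eq => a; apply: proj_inj0.
- move=> I F; apply: nat_trans_eq => a; rewrite [LHS]nt_sum.
  exact: inj_proj.
- exact: functor_idempotents_split.
Defined.

End FunctorAdditiveKaroubian.

(** * The tensor product distributes over biproducts *)

Section TensorSums.
Variables (X : ab_category) (T : ab_algebra X).

Lemma tensh0l (a b a' b' : X) (g : b ~> b') : tensh T (0 : a ~> a') g = 0.
Proof. by apply: (addrI (tensh T (0 : a ~> a') g)); rewrite -tensDl !addr0. Qed.

Lemma tensh0r (a b a' b' : X) (f : a ~> a') : tensh T f (0 : b ~> b') = 0.
Proof. by apply: (addrI (tensh T f (0 : b ~> b'))); rewrite -tensDr !addr0. Qed.

Lemma tensh_suml (a b a' b' : X) (I : finType) (f : I -> (a ~> a'))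
    (g : b ~> b') : tensh T (\sum_i f i) g = \sum_i tensh T (f i) g.
Proof.
apply: (big_morph (fun h => tensh T h g)) => [u v|];
  by rewrite (tensDl, tensh0l).
Qed.

Lemma tensh_sumr (a b a' b' : X) (I : finType) (f : a ~> a')
    (g : I -> (b ~> b')) : tensh T f (\sum_i g i) = \sum_i tensh T f (g i).
Proof.
apply: (big_morph (fun h => tensh T f h)) => [u v|];
  by rewrite (tensDr, tensh0r).
Qed.

Lemma tens_inj_ext (I J : finType) (D : I -> X) (D' : J -> X) (a : X)
    (x y : tens T (dsum T D) (dsum T D') ~> a) :
  (forall i j, x ∘ tensh T (inj T D i) (inj T D' j) =
               y ∘ tensh T (inj T D i) (inj T D' j)) -> x = y.
Proof.
move=> e; rewrite -[x]cmpm1 -[y]cmpm1 -tens1 -!inj_proj tensh_suml !cmp_sumr.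
apply: eq_bigr => i _; rewrite tensh_sumr !cmp_sumr; apply: eq_bigr => j _.
by rewrite tensM !cmpA e.
Qed.

End TensorSums.

(** * The convolution structure *)

Section Convolution.
Variables (C : category) (W : factorisation_system C).
Hypotheses (Wmono : M_monic W) (Wpb : M_pullbacks W).
Variables (S : subobjects W) (X : ab_category) (T : ab_algebra X).
Local Notation R := (E_category W).
Local Notation P := (Par Wmono Wpb).
Local Notation GammaO := (Gamma_obj Wmono Wpb S T).
Local Notation tot := (tot Wmono Wpb).
Local Notation res := (res Wmono Wpb).
Local Notation Gamma_in := (Gamma_in Wmono Wpb T).
Local Notation Gamma_out := (Gamma_out Wmono Wpb T).

(** * The unit as the core of the constant functor *)

Section Unit.

(** The [return] clause repeats the test in [conv_unit_obj], so that the type reduces along with the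
    value. *)
Definition unit_inc (a : C) : conv_unit_obj S T a ~> tunit T :=
  if #|Sub S a| == 1%N as b
    return ((if b then tunit T else zero_obj T) ~> tunit T)
  then idm (tunit T) else 0.

Definition unit_ret (a : C) : tunit T ~> conv_unit_obj S T a :=
  if #|Sub S a| == 1%N as b
    return (tunit T ~> (if b then tunit T else zero_obj T))
  then idm (tunit T) else 0.

Lemma unit_retK (a : C) : unit_ret a ∘ unit_inc a = idm _.
Proof.
rewrite /unit_ret /unit_inc /conv_unit_obj; case: eqP => _.
  by rewrite cmp1m.
by rewrite zero_obj_idm cmp0m.
Qed.

Lemma unit_incK (a : C) : #|Sub S a| == 1%N ->
  unit_inc a ∘ unit_ret a = idm (tunit T).
Proof.
by rewrite /unit_ret /unit_inc /conv_unit_obj => ->; rewrite cmp1m.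
Qed.

Lemma unit_inc0 (a : C) : ~~ (#|Sub S a| == 1%N) -> unit_inc a = 0.
Proof. by rewrite /unit_inc /conv_unit_obj => /negPf ->. Qed.

Lemma unit_ret0 (a : C) : ~~ (#|Sub S a| == 1%N) -> unit_ret a = 0.
Proof. by rewrite /unit_ret /conv_unit_obj => /negPf ->. Qed.

Lemma not_single_sub (a b : C) (m : b ~> a) :
  Mcl W m -> ~ is_iso m -> ~~ (#|Sub S a| == 1%N).
Proof.
by move=> Mm niso; apply/negP => /(single_subP S Wmono) iso; apply/niso/iso.
Qed.

Local Notation H := (pt_unit P T).

Lemma unit_inc_E (a a' : C) (e : a ~> a') : Ecl W e ->
  unit_inc a' ∘ (unit_ret a' ∘ (fmap H (tot e) ∘ unit_inc a)) =
  fmap H (tot e) ∘ unit_inc a.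
Proof.
move=> Ee /=; rewrite cmp1m cmpA.
have [a1|a1] := boolP (#|Sub S a| == 1%N); last by rewrite (unit_inc0 a1) cmpm0.
by rewrite unit_incK ?cmp1m //; apply: single_sub_image Ee a1.
Qed.

Lemma unit_inc_res (a b : C) (m : b ~> a) (Mm : Mcl W m) : ~ is_iso m ->
  fmap H (res Mm) ∘ unit_inc a = 0.
Proof.
by move=> niso; rewrite unit_inc0 ?cmpm0 //; apply: not_single_sub niso.
Qed.

Lemma unit_ret_tot (a b : C) (m : b ~> a) : Mcl W m -> ~ is_iso m ->
  unit_ret a ∘ fmap H (tot m) = 0.
Proof.
by move=> Mm niso; rewrite unit_ret0 ?cmp0m //; apply: not_single_sub niso.
Qed.

Lemma unit_inc_ext (a : C) (x : X) (y z : H a ~> x) :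
  (forall n : Sub S a,
    y ∘ (fmap H (tot (sub_map S n)) ∘ unit_inc (sub_obj S n)) =
    z ∘ (fmap H (tot (sub_map S n)) ∘ unit_inc (sub_obj S n))) -> y = z.
Proof.
(* At a subobject with a single subobject the core is all of [I], and the constant functor sends its
   inclusion to the identity. *)
have [b b1] := single_sub_exists S Wmono a.
move=> /(_ b) /= /(congr1 (fun w => w ∘ unit_ret (sub_obj S b))).
by rewrite -!cmpA unit_incK // !cmpm1.
Qed.

Definition conv_unit : functor R X :=
  core_functor (H := H) unit_retK unit_inc_E.

Lemma Gamma_conv_unit_iso : exists eta : nat_trans H (GammaO conv_unit),
  @is_iso (functor_category P X) _ _ eta.
Proof.
have [g [gr rg]] := recompose_iso (H := H) T unit_retK unit_inc_E unit_inc_res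
  unit_ret_tot unit_inc_ext.
(* [recompose] goes out of [Gamma]; a monoidal structure map goes into it, hence the inverse. *)
by exists g; exists (recompose (H := H) S T unit_retK unit_inc_E unit_inc_res).
Qed.

End Unit.

(** * The convolution as the core of a pointwise tensor product *)

Section Tensor.
Variables F G : functor R X.
Local Notation H := (pt_tens T (GammaO F) (GammaO G)).

Definition tens_in (a : C) (n n' : Sub S a) :
  tens T (F (sub_obj S n)) (G (sub_obj S n')) ~> H a :=
  tensh T (Gamma_in F n) (Gamma_in G n').

Definition summand_in (a : C) (p : covering_pairs S a) :
  tens T (F (sub_obj S (val p).1)) (G (sub_obj S (val p).2)) ~>
  conv_tens_obj S T F G a :=
  inj T (fun q : covering_pairs S a =>
    tens T (F (sub_obj S (val q).1)) (G (sub_obj S (val q).2))) p.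

Lemma summand_in_ext (a : C) (x : X) (y z : conv_tens_obj S T F G a ~> x) :
  (forall p, y ∘ summand_in p = z ∘ summand_in p) -> y = z.
Proof. exact: inj_ext. Qed.

Definition conv_inc (a : C) : conv_tens_obj S T F G a ~> H a :=
  copair T (fun p : covering_pairs S a => tens_in (val p).1 (val p).2).

Definition conv_ret (a : C) : H a ~> conv_tens_obj S T F G a :=
  pair T (fun p : covering_pairs S a =>
    tensh T (Gamma_out F (val p).1) (Gamma_out G (val p).2)).

Lemma conv_inc_in (a : C) (p : covering_pairs S a) :
  conv_inc a ∘ summand_in p = tens_in (val p).1 (val p).2.
Proof. exact: copair_inj. Qed.

Lemma proj_conv_ret (a : C) (p : covering_pairs S a) :
  proj T (fun q : covering_pairs S a =>
    tens T (F (sub_obj S (val q).1)) (G (sub_obj S (val q).2))) p ∘ conv_ret a =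
  tensh T (Gamma_out F (val p).1) (Gamma_out G (val p).2).
Proof. exact: proj_pair. Qed.

Lemma tens_in_ext (a : C) (x : X) (y z : H a ~> x) :
  (forall n n', y ∘ tens_in n n' = z ∘ tens_in n n') -> y = z.
Proof. exact: tens_inj_ext. Qed.

Lemma tens_in_out0 (a : C) (n n' k k' : Sub S a) : (n, n') <> (k, k') ->
  tensh T (Gamma_out F k) (Gamma_out G k') ∘ tens_in n n' = 0.
Proof.
move=> nk; rewrite -tensM; have [e|e] := EM (n = k).
  rewrite (@Gamma_out_in0 _ _ _ _ _ _ _ G) ?tensh0r // => e'.
  by apply: nk; rewrite e e'.
by rewrite Gamma_out_in0 // tensh0l.
Qed.

Lemma conv_ret_in (a : C) (p : covering_pairs S a) :
  conv_ret a ∘ tens_in (val p).1 (val p).2 = summand_in p.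
Proof.
apply: proj_ext => q; rewrite cmpA proj_conv_ret.
have [<-|pq] := EM (p = q); first by rewrite proj_injE -tensM !Gamma_outK tens1.
rewrite proj_inj0 // tens_in_out0 // => e; apply/pq/val_inj.
by rewrite [val p]surjective_pairing e -surjective_pairing.
Qed.

Lemma conv_ret_in0 (a : C) (n n' : Sub S a) : ~ covering n n' ->
  conv_ret a ∘ tens_in n n' = 0.
Proof.
move=> ncov; apply: proj_ext => q; rewrite cmpA proj_conv_ret cmpm0.
apply: tens_in_out0 => e; apply: ncov.
have := valP q; rewrite [val q]surjective_pairing -e => /asboolP.
by [].
Qed.

Lemma conv_retK (a : C) : conv_ret a ∘ conv_inc a = idm _.
Proof.
by apply: summand_in_ext => p; rewrite -cmpA conv_inc_in conv_ret_in cmp1m.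
Qed.

Lemma conv_inc_ret_in (a : C) (n n' : Sub S a) : covering n n' ->
  conv_inc a ∘ (conv_ret a ∘ tens_in n n') = tens_in n n'.
Proof.
move=> /asboolP cov; pose p : covering_pairs S a := exist _ (n, n') cov.
by rewrite (conv_ret_in p) (conv_inc_in p).
Qed.

Lemma tot_tens_in (a a' : C) (f : a ~> a') (n n' : Sub S a) (k k' : Sub S a')
    (e : E_hom W (sub_obj S n) (sub_obj S k))
    (e' : E_hom W (sub_obj S n') (sub_obj S k')) :
  f ∘ sub_map S n = sub_map S k ∘ sval e ->
  f ∘ sub_map S n' = sub_map S k' ∘ sval e' ->
  fmap H (tot f) ∘ tens_in n n' = tens_in k k' ∘ tensh T (fmap F e) (fmap G e').
Proof.
move=> fe fe'; rewrite [fmap H _]/(tensh T _ _) -!tensM.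
by rewrite (Gamma_tot _ _ _ F fe) (Gamma_tot _ _ _ G fe').
Qed.

(** By [covering_image], an E-map sends covering summands to covering summands. *)
Lemma conv_inc_E (a a' : C) (e : a ~> a') : Ecl W e ->
  conv_inc a' ∘ (conv_ret a' ∘ (fmap H (tot e) ∘ conv_inc a)) =
  fmap H (tot e) ∘ conv_inc a.
Proof.
move=> Ee; apply: summand_in_ext => p; rewrite -!cmpA conv_inc_in.
have [k [d kd]] := tot_image e (val p).1.
have [k' [d' kd']] := tot_image e (val p).2.
rewrite (tot_tens_in kd kd') (cmpA (conv_ret _)) cmpA conv_inc_ret_in //.
apply: (covering_image Wmono Wpb Ee (asboolP _ (valP p))).
  by rewrite kd; exists (sval d).
by rewrite kd'; exists (sval d').
Qed.

(** A summand survives the restriction only if both members of its pair factor through [m], which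
    covering pairs do only for invertible [m]. *)
Lemma conv_inc_res (a b : C) (m : b ~> a) (Mm : Mcl W m) : ~ is_iso m ->
  fmap H (res Mm) ∘ conv_inc a = 0.
Proof.
move=> niso; apply: summand_in_ext => p; rewrite -cmpA conv_inc_in cmp0m.
rewrite [fmap H _]/(tensh T _ _) -tensM.
have [nm|nm] := EM (factors (sub_map S (val p).1) m); last first.
  by rewrite Gamma_res0 // tensh0l.
rewrite (@Gamma_res0 _ _ _ _ _ _ _ G) ?tensh0r // => n'm.
by apply: niso; have /asboolP := valP p; apply.
Qed.

Lemma conv_ret_tot (a b : C) (m : b ~> a) : Mcl W m -> ~ is_iso m ->
  conv_ret a ∘ fmap H (tot m) = 0.
Proof.
move=> Mm niso; apply: tens_in_ext => n n'; rewrite cmp0m -cmpA.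
have [k [d kd]] := tot_image m n; have [k' [d' kd']] := tot_image m n'.
(* The image of an M-map along [m] is again an M-map, so its E-part is invertible. The image pair
   therefore factors through the proper [m] and cannot cover. *)
have fac (l : Sub S b) (j : Sub S a) (e : E_hom W (sub_obj S l) (sub_obj S j)) :
    m ∘ sub_map S l = sub_map S j ∘ sval e -> factors (sub_map S j) m.
  move=> me; have [g [gd dg]] : is_iso (sval e).
    apply: EM_iso (svalP e) _; apply: M_cancel (sub_M j) _; rewrite -me.
    by apply: M_cmp Mm _; apply: sub_M.
  by exists (sub_map S l ∘ g); rewrite cmpA me -cmpA dg cmpm1.
rewrite (tot_tens_in kd kd') cmpA conv_ret_in0 ?cmp0m // => cov.
by apply/niso/cov => //; [apply: fac kd | apply: fac kd'].
Qed.

Lemma conv_inc_ext (a : C) (x : X) (y z : H a ~> x) :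
  (forall n : Sub S a,
    y ∘ (fmap H (tot (sub_map S n)) ∘ conv_inc (sub_obj S n)) =
    z ∘ (fmap H (tot (sub_map S n)) ∘ conv_inc (sub_obj S n))) -> y = z.
Proof.
move=> yz; apply: tens_in_ext => n n'.
have [b [k [k' [i [i' [cov isoi isoi' bk bk']]]]]] :=
  covering_exists Wmono n n'.
have /asboolP covb := cov.
pose p : covering_pairs S (sub_obj S b) := exist _ (k, k') covb.
pose e : E_hom W (sub_obj S k) (sub_obj S n) := exist _ i (E_iso W isoi).
pose e' : E_hom W (sub_obj S k') (sub_obj S n') := exist _ i' (E_iso W isoi').
have := congr1 (fun w => w ∘ summand_in p) (yz b).
rewrite -!cmpA conv_inc_in (@tot_tens_in _ _ _ k k' n n' e e' bk bk') !cmpA.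
have fe_iso (M : functor R X) (u v : R) (d : u ~> v) :
    is_iso d -> is_iso (fmap M d).
  move=> [d1 [d1d dd1]]; exists (fmap M d1).
  by rewrite -!fmapM d1d dd1 !fmap1.
have E_iso' (u v : C) (f : u ~> v) (jf : is_iso f) :
    @is_iso R u v (exist _ f (E_iso W jf)).
  have [g [gf fg]] := jf.
  have jg : is_iso g by exists f.
  by exists (exist _ g (E_iso W jg)); split; apply: E_hom_eq.
(* By [covering_exists], the summand at [n], [n'] is the total image of a covering one up to the
   isomorphisms [e] and [e'], which are cancelled here. *)
apply: iso_epi; apply: tensh_iso; apply: fe_iso; exact: E_iso'.
Qed.

Definition conv_tens : functor R X :=
  core_functor (H := H) conv_retK conv_inc_E.

Lemma Gamma_conv_tens_iso : exists mu : nat_trans H (GammaO conv_tens),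
  @is_iso (functor_category P X) _ _ mu.
Proof.
have [g [gr rg]] := recompose_iso (H := H) T conv_retK conv_inc_E conv_inc_res
  conv_ret_tot conv_inc_ext.
by exists g; exists (recompose (H := H) S T conv_retK conv_inc_E conv_inc_res).
Qed.

End Tensor.

(** * The convolution algebra *)

Local Notation GammaF := (Gamma Wmono Wpb S T).
Local Notation RX := (functor_ab_category R X).
Local Notation PX := (functor_ab_category P X).
Local Notation PT := (pointwise P T : monoidal PX).

Definition conv_mu (F G : RX) : tens PT (GammaF F) (GammaF G) ~>
  GammaF (conv_tens F G) := projT1 (cid (Gamma_conv_tens_iso F G)).

Lemma conv_mu_iso (F G : RX) : is_iso (conv_mu F G).
Proof. exact: projT2 (cid (Gamma_conv_tens_iso F G)). Qed.

Definition conv_eta : tunit PT ~> GammaF conv_unit :=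
  projT1 (cid Gamma_conv_unit_iso).

Lemma conv_eta_iso : is_iso conv_eta.
Proof. exact: projT2 (cid Gamma_conv_unit_iso). Qed.

Definition conv_monoidal : monoidal RX :=
  transported (@Gamma_full _ _ Wmono Wpb S X T)
    (@Gamma_faithful _ _ Wmono Wpb S X T) conv_mu_iso conv_eta_iso.

(** Both sides are presented by the same map, because Gamma and the pointwise tensor are
    additive. *)
Lemma conv_tensDl (F G F' G' : RX) (f f' : F ~> F') (g : G ~> G') :
  tensh conv_monoidal (f + f') g =
  tensh conv_monoidal f g + tensh conv_monoidal f' g.
Proof.
apply: (presents_inj (F := GammaF) (@Gamma_faithful _ _ Wmono Wpb S X T)
  (conv_mu_iso F G) (tr_tenshP _ conv_mu_iso _ _)); last by [].
rewrite /presents [fmap _ _]Gamma_additive cmpDl !tr_tenshP Gamma_additive.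
rewrite -cmpDr; congr (_ ∘ _); apply: nat_trans_eq => a; symmetry.
exact: tensDl.
Qed.

Lemma conv_tensDr (F G F' G' : RX) (f : F ~> F') (g g' : G ~> G') :
  tensh conv_monoidal f (g + g') =
  tensh conv_monoidal f g + tensh conv_monoidal f g'.
Proof.
apply: (presents_inj (F := GammaF) (@Gamma_faithful _ _ Wmono Wpb S X T)
  (conv_mu_iso F G) (tr_tenshP _ conv_mu_iso _ _)); last by [].
rewrite /presents [fmap _ _]Gamma_additive cmpDl !tr_tenshP Gamma_additive.
rewrite -cmpDr; congr (_ ∘ _); apply: nat_trans_eq => a; symmetry.
exact: tensDr.
Qed.

Definition conv_algebra : ab_algebra RX :=
  @AbAlgebra RX (functor_additive_karoubian R T) conv_monoidal
    conv_tensDl conv_tensDr.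

End Convolution.

(** * Pointwise symmetry and conclusion *)

Lemma pointwise_symmetry (D C : category) (T : monoidal C) (B : symmetry T) :
  symmetry (pointwise D T).
Proof.
have bN (F G : functor D C) (a b : D) (f : a ~> b) :
    braid B (F b) (G b) ∘ fmap (pt_tens T F G) f =
    fmap (pt_tens T G F) f ∘ braid B (F a) (G a) by apply: braidN.
exists (fun F G => @NatTrans D C (pt_tens T F G) (pt_tens T G F)
  (fun a => braid B (F a) (G a)) (bN F G)).
- by move=> *; apply: nat_trans_eq => a; apply: braidN.
- by move=> *; apply: nat_trans_eq => a; apply: braidK.
- by move=> *; apply: nat_trans_eq => a; apply: hexagon.
Qed.

Theorem proposition7p1
    (C : category) (W : factorisation_system C)
    (Wmono : M_monic W) (Wpb : M_pullbacks W) (S : subobjects W)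
    (X : ab_category) (T : ab_algebra X) :
  (exists TR : ab_algebra (functor_ab_category (E_category W) X),
     is_convolution S T TR /\
     inhabited (strong_monoidal TR (pointwise (Par Wmono Wpb) T)
       (Gamma Wmono Wpb S T))) /\
  (symmetry T ->
   exists TR : ab_algebra (functor_ab_category (E_category W) X),
     inhabited (symmetry TR) /\
     is_convolution S T TR /\
     inhabited (strong_monoidal TR (pointwise (Par Wmono Wpb) T)
       (Gamma Wmono Wpb S T))).
Proof.
(* The core functors were built on exactly the prescribed objects, so this holds by computation. *)
have conv : is_convolution S T (conv_algebra Wmono Wpb S T) by [].
have strong := transported_strong (@Gamma_full _ _ Wmono Wpb S X T)
  (@Gamma_faithful _ _ Wmono Wpb S X T) (conv_mu_iso Wmono Wpb S T)
  (conv_eta_iso Wmono Wpb S T).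
split=> [|B]; exists (conv_algebra Wmono Wpb S T).
  by split=> //; constructor; apply: strong.
split; last by split=> //; constructor; apply: strong.
constructor; apply: transported_symmetry.
exact: pointwise_symmetry B.
Qed.
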